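(* Let $r\in(0,1]$ and $\delta>0$, and let $\rho_\delta$ be the unique positive solution $s$ of the generalized Lundberg fundamental equation $$\frac{\sigma^2}{2}s^2+cs-(\lambda+\delta)+\lambda r\,\hat p(s)=0 .$$ Then, for any $x>0$, $$e^{-\rho_\delta x}=\sum_{n=0}^\infty r^n\int_0^\infty e^{-\delta s}\,\frac{x}{s}\,g_s(n,x)\,ds .$$
   Context: Constants: $c>0$, $\lambda>0$, $\sigma>0$, and $D=\sigma^2/2$. Let $p$ be the probability density function on $(0,\infty)$ of a positive random variable $X_1$ satisfying the net profit condition $c>\lambda\,\mathbb{E}(X_1)$, and let $\hat p(s)=\int_0^\infty e^{-sx}p(x)\,dx$ be its Laplace transform. For $n\ge 1$, $p^{n*}$ denotes the $n$-fold convolution of $p$ with itself. For $t>0$ and $x\in\mathbb{R}$ define $$g_t(0,x)=\frac{1}{2\sqrt{\pi Dt}}\,e^{-\left(\lambda t+\frac{(x-ct)^2}{4Dt}\right)},$$ $$g_t(n,x)=e^{-\lambda t}\frac{(\lambda t)^n}{n!}\int_0^\infty\frac{1}{2\sqrt{\pi Dt}}\,e^{-\frac{(z+x-ct)^2}{4Dt}}\,p^{n*}(z)\,dz,\qquad n\ge 1 .$$ Under these assumptions the generalized Lundberg fundamental equation has exactly one positive solution, so $\rho_\delta$ (which depends also on $r$) is well defined. *)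

(* Defs.v *)
From HB Require Import structures.
From mathcomp Require Import all_boot all_order all_algebra.
From mathcomp Require Import all_classical all_reals all_analysis.
Import Order.TTheory GRing.Theory Num.Theory.
Import numFieldNormedType.Exports.

Set Implicit Arguments.
Unset Strict Implicit.
Unset Printing Implicit Defensive.

Local Open Scope classical_set_scope.
Local Open Scope ring_scope.

(* Values of p outside ]0, +oo[ are irrelevant here and in every definition
   below; the law of X is therefore concentrated on ]0, +oo[. *)
Definition has_pos_density (R : realType) (d : measure_display)
    (T : measurableType d) (P : probability T R) (X : {RV P >-> R})
    (p : R -> R) : Prop :=
  [/\ measurable_fun `](0 : R), +oo[ p,
      forall x, 0 < x -> 0 <= p x &
      forall A : set R, measurable A ->
        distribution P X A =
        (\int[lebesgue_measure]_(x in A `&` `]0%R, +oo[) (p x)%:E)%E].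

Definition laplace (R : realType) (p : R -> R) (s : R) : R :=
  \int[lebesgue_measure]_(x in `]0, +oo[) (expR (- (s * x)) * p x).

(* Convolution of functions supported on ]0, +oo[: the integrand
   f (x - y) * g y vanishes unless 0 < y < x. It is extended-real valued
   because the integral may diverge at exceptional points x. *)
Definition conv (R : realType) (f g : R -> \bar R) (x : R) : \bar R :=
  (\int[lebesgue_measure]_(y in `]0%R, x[) (f (x - y)%R * g y))%E.

(* The n-fold convolution for 1 <= n; the value at n = 0 is a dummy. *)
Definition conv_pow (R : realType) (p : R -> R) (n : nat) : R -> \bar R :=
  iter n.-1 (fun f => conv f (EFin \o p)) (EFin \o p).

Definition g (R : realType) (c lambda sigma : R) (p : R -> R)
    (t : R) (n : nat) (x : R) : \bar R :=
  let D := sigma ^+ 2 / 2 in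
  if n is 0 then
    ((2 * Num.sqrt (pi * D * t))^-1 *
      expR (- (lambda * t + (x - c * t) ^+ 2 / (4 * D * t))))%:E
  else
    ((expR (- (lambda * t)) * ((lambda * t) ^+ n / n`!%:R))%:E *
      \int[lebesgue_measure]_(z in `]0%R, +oo[)
        (((2 * Num.sqrt (pi * D * t))^-1 *
           expR (- ((z + x - c * t) ^+ 2 / (4 * D * t))))%:E *
         conv_pow p n z))%E.

Definition lundberg (R : realType) (c lambda sigma r delta : R) (p : R -> R)
    (s : R) : R :=
  sigma ^+ 2 / 2 * s ^+ 2 + c * s - (lambda + delta)
  + lambda * r * laplace p s.

(* Definite description: the s such that {s} is the set of all positive
   solutions; the default 0 is taken only if there is no such s. *)
Definition rho (R : realType) (c lambda sigma r delta : R) (p : R -> R) : R :=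
  xget 0 [set s | [set u | 0 < u /\ lundberg c lambda sigma r delta p u = 0]
                  = [set s]].

(* Main.v *)
Require Import Defs.
From HB Require Import structures.
From mathcomp Require Import all_boot all_order all_algebra.
From mathcomp Require Import all_classical all_reals all_analysis.
From mathcomp Require Import measurable_realfun ring lra.
Import Order.TTheory GRing.Theory Num.Theory.
Import numFieldNormedType.Exports.
Local Open Scope classical_set_scope.
Local Open Scope ring_scope.
Set Implicit Arguments.
Unset Strict Implicit.
Unset Printing Implicit Defensive.

(** Let [phi_s] be the density of the Brownian motion with drift [c] at time [s].
The first passage density over [x] is [h_x(s) = x / s * phi_s(x)]; it satisfies
[h_x * phi(y) = phi(x + y)] (convolution in the time variable) and its Laplace transform at
[D b^2 + c b] is [expR (- (b x))]. Put [q = lambda + delta], [w = lambda r] and let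
[K_n(y)] be the integral of [expR (- (q s)) s^(n-1) phi_s(y)]. The [n]-th term of
the series is [b_n(x) = x w^n / n! E[K_n(x + S_n)]], [S_n] being the sum of [n]
claims.

Kendall's identity in the form [b_n = \sum_(1 <= k <= n) Psi_k b_(n-k)], where
[Psi_k f(x) = w^k / k! x K_k(x) E[f(S_k)]] counts the claims arriving while the
Brownian motion climbs from [0] to [x], follows from the convolution identity and from
[E[S_k f(S_n)] = k / n E[S_n f(S_n)]] (exchangeability). For a root [rho] of the
Lundberg equation, [E(x) = expR (- (rho x))] solves the same equation
[E = b_0 + \sum_(k >= 1) Psi_k E]. Hence the partial sums of the series are at most
[E]; and since [\sum_(k >= 1) Psi_k 1 <= kappa < 1], iterating gives
[E <= \sum_n b_n + kappa^j] for all [j], so that [E = \sum_n b_n]. As this holds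
for every positive root, the root is unique. *)

(** * Lebesgue integrals on the line *)

Section lebesgue_translation.
Context {R : realType}.
Notation leb := (@lebesgue_measure R).

(** The translated measure agrees with Lebesgue measure on half-open intervals, which determine
    it. *)
Lemma lebesgue_measure_shift (a : R) (A : set (measurableTypeR R)) : measurable A ->
  leb A = pushforward leb (fun x : measurableTypeR R => (x + a) : measurableTypeR R) A.
Proof.
have mf : measurable_fun [set: measurableTypeR R]
    (fun x : measurableTypeR R => x + a : measurableTypeR R).
  by apply: measurable_funD.
pose m : {measure set (measurableTypeR R) -> \bar R} :=
  @measure_function_pushforward__canonical__measure_function_Measure _ _ _ _ _ leb _ mf.
apply: (@lebesgue_measure_unique R m) => _ [[u v] _ <-] /=.
rewrite /pushforward.
have -> : (fun x : R => x + a) @^-1` `]u, v]%classic = `]u - a, v - a]%classic.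
  by apply/seteqP; split => x /=; rewrite !in_itv /= lerBrDr ltrBlDr.
rewrite !lebesgue_measure_itv /= !lte_fin ltrD2r.
by case: ifP => // _; rewrite -!EFinD; congr EFin; ring.
Qed.

Lemma integral_shift (a : R) (f : R -> \bar R) : measurable_fun setT f ->
  (forall x, (0 <= f x)%E) ->
  (\int[leb]_x f (x + a)%R = \int[leb]_x f x)%E.
Proof.
move=> mf f0.
have ms : measurable_fun [set: measurableTypeR R]
    (fun x : measurableTypeR R => x + a : measurableTypeR R).
  by apply: measurable_funD.
pose m : {measure set (measurableTypeR R) -> \bar R} :=
  @measure_function_pushforward__canonical__measure_function_Measure _ _ _ _ _ leb _ ms.
rewrite [RHS](eq_measure_integral m); last first.
  by move=> A mA _; exact: lebesgue_measure_shift.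
by rewrite (ge0_integral_pushforward ms)// => x _; exact: f0.
Qed.

End lebesgue_translation.

Section measurability.
Context {R : realType}.

Lemma measurable_inv : measurable_fun setT (fun x : R => x^-1).
Proof.
(* Squaring makes the base nonnegative, where the power with exponent -1 is the inverse; at 0 both
   sides are 0. *)
have -> : (fun x : R => x^-1) = (fun x => x * (x ^+ 2) `^ (-1)).
  apply/funext => x; have [->|x0] := eqVneq x 0; first by rewrite invr0 mul0r.
  by rewrite powR_inv1 ?sqr_ge0// expr2 invfM mulrA divff// mul1r.
apply: measurable_funM => //.
exact: (measurableT_comp (@measurable_powR R (-1)) (@exprn_measurable _ setT 2)).
Qed.

Lemma measurable_sqrt : measurable_fun setT (@Num.sqrt R).
Proof.
have -> : @Num.sqrt R = (fun x => (Num.max x 0) `^ (2^-1)).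
  apply/funext => x; rewrite powR12_sqrt ?le_max ?lexx ?orbT// maxElt.
  by case: ltP => // x0; rewrite sqrtr0 ler0_sqrtr// ltW.
by apply: (measurableT_comp (@measurable_powR R 2^-1)); exact: measurable_maxr.
Qed.

End measurability.

(** * Gaussian integrals *)

Section gauss.
Context {R : realType}.
Notation leb := (@lebesgue_measure R).

(** An improper fundamental theorem: the compact intervals increase, so for nonnegative [f] monotone
    convergence passes to the union and the limits of [F] along the endpoints suffice. *)
Lemma ge0_FTC_bigcup (f F : R -> R) (u v : nat -> R) (l L : R) :
  (forall n, u n < v n) ->
  {homo u : n m / (n <= m)%N >-> m <= n} ->
  {homo v : n m / (n <= m)%N >-> n <= m} ->
  (forall n x, u n <= x <= v n -> is_derive x 1 F (f x)) ->
  (forall n x, u n <= x <= v n -> {for x, continuous f}) ->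
  (forall n x, u n <= x <= v n -> 0 <= f x) ->
  F (u n) @[n --> \oo] --> l -> F (v n) @[n --> \oo] --> L ->
  (\int[leb]_(x in \bigcup_n `[u n, v n]%classic) (f x)%:E = (L - l)%:E)%E.
Proof.
move=> uv nu nv dF cf f0 Fl FL.
have cfw n : {within `[u n, v n], continuous f}.
  apply: continuous_in_subspaceT => x; rewrite inE /= in_itv /=.
  exact: cf.
have mf n : measurable_fun `[u n, v n]%classic (EFin \o f).
  apply/measurable_EFinP; exact: subspace_continuous_measurable_fun.
have I n : (\int[leb]_(x in `[u n, v n]%classic) (f x)%:E = (F (v n) - F (u n))%:E)%E.
  rewrite (@continuous_FTC2 _ f F)//.
  - have dw : {within `[u n, v n], continuous F}.
      apply: derivable_within_continuous => x; rewrite in_itv /= => xuv.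
      by have [] := dF n x xuv.
    move/(continuous_within_itvP _ (uv n)) : dw => [_ c1 c2]; split => //.
    move=> x; rewrite in_itv /= => /andP[/ltW xu /ltW xv].
    by have [] := dF n x; rewrite ?xu ?xv.
  - move=> x; rewrite in_itv /= => /andP[/ltW xu /ltW xv].
    rewrite derive1E.
    by have [|_ ->] := dF n x; rewrite ?xu ?xv.
have H : (\int[leb]_(x in `[u n, v n]%classic) (f x)%:E @[n --> \oo] -->
   \int[leb]_(x in \bigcup_n `[u n, v n]%classic) (f x)%:E)%E.
  apply: ge0_nondecreasing_set_cvg_integral => //.
  - move=> n m nm; apply/subsetPset => x /=; rewrite !in_itv /= => /andP[h1 h2].
    by rewrite (le_trans (nu _ _ nm))//= (le_trans h2)//; exact: nv.
rewrite -(cvg_lim _ H)//; apply/cvg_lim => //.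
under eq_fun do rewrite I.
by apply: cvg_EFin; [exact: nearW|exact: cvgB].
Qed.

(* Not normalized: the total mass is [Num.sqrt pi]. *)
Definition gauss_cdf (v : R) : R := \int[leb]_(t in `]-oo, v]) gauss_fun t.

Lemma integrable_gaussS (A : set R) : measurable A ->
  leb.-integrable A (EFin \o gauss_fun).
Proof. by move=> mA; apply: integrableS (@integrableT_gauss R). Qed.

Lemma is_derive_gauss_cdf (v : R) : is_derive v 1 gauss_cdf (gauss_fun v).
Proof.
have [] := @continuous_FTC1 R gauss_fun -oo%O v (v + 1).
- by rewrite ltrDl.
- exact: integrable_gaussS.
- by rewrite ltNyr.
- exact: continuous_gauss_fun.
by move=> h1 h2; split => //; rewrite -derive1E.
Qed.

(** Moves the dependence on [v] from the domain into the integrand, the form required by dominated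
    convergence. *)
Lemma gauss_cdfE (v : R) :
  (gauss_cdf v)%:E = (\int[leb]_t (if t <= v then gauss_fun t else 0)%:E)%E.
Proof.
rewrite /gauss_cdf /Rintegral fineK; last first.
  apply: integrable_fin_num => //; exact: integrable_gaussS.
rewrite integral_mkcond; apply: eq_integral => t _; rewrite patchE.
by rewrite mem_setE in_itv /=; case: ifP.
Qed.

(** Dominated convergence with [gauss_fun] as bound; [h] will be [gauss_fun] at [+oo] and 0 at
    [-oo]. *)
Lemma gauss_cdf_cvg (w : nat -> R) (h : R -> R) :
  (forall t, (if t <= w n then gauss_fun t else 0) @[n --> \oo] --> h t) ->
  (gauss_cdf (w n))%:E @[n --> \oo] --> (\int[leb]_t (h t)%:E)%E.
Proof.
move=> H.
under eq_fun do rewrite gauss_cdfE.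
apply: (@dominated_cvg _ (measurableTypeR R) R leb setT measurableT
  (fun n (t : R) => (if t <= w n then gauss_fun t else 0)%:E) (EFin \o h) (EFin \o gauss_fun)) => //.
- move=> n; apply/measurable_EFinP; apply: measurable_fun_ifT => //.
  + by apply: measurable_fun_ler.
  + exact: measurable_gauss_fun.
- by move=> t _; apply: cvg_EFin; [exact: nearW|exact: H].
- exact: integrable_gaussS.
- move=> n t _ /=; rewrite lee_fin; case: ifP => _.
    by rewrite ger0_norm// gauss_fun_ge0.
  by rewrite normr0 gauss_fun_ge0.
Qed.

Lemma gauss_cdf_cvgy (w : nat -> R) : w n @[n --> \oo] --> +oo ->
  gauss_cdf (w n) @[n --> \oo] --> Num.sqrt pi.
Proof.
move=> wy; suff /fine_cvg : (gauss_cdf (w n))%:E @[n --> \oo] --> (Num.sqrt pi)%:E by [].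
rewrite -integralT_gauss; apply: gauss_cdf_cvg => t.
apply: cvg_near_cst; near=> n; rewrite ifT//.
by near: n; exact: (cvgry_ge wy).
Unshelve. all: end_near. Qed.

Lemma gauss_cdf_cvgNy (w : nat -> R) : w n @[n --> \oo] --> -oo ->
  gauss_cdf (w n) @[n --> \oo] --> (0 : R).
Proof.
move=> wy; suff /fine_cvg : (gauss_cdf (w n))%:E @[n --> \oo] --> 0%:E by [].
have <- : (\int[leb]_t ((fun=> 0) t : R)%:E)%E = 0%:E by rewrite integral0.
apply: (@gauss_cdf_cvg w (fun=> 0)) => t.
apply: cvg_near_cst; near=> n; rewrite ifF//.
apply/negbTE; rewrite -ltNge.
by near: n; exact: (cvgrNy_lt wy).
Unshelve. all: end_near. Qed.

Lemma cvgDry (f h : nat -> R) (l : R) : f n @[n --> \oo] --> l ->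
  h n @[n --> \oo] --> +oo -> f n + h n @[n --> \oo] --> +oo.
Proof.
move=> fl hy; apply/cvgryPge => A; near=> n.
have h1 : l - 1 <= f n by near: n; apply: (cvgr_ge _ fl); rewrite ltrBlDr ltrDl.
have h2 : A - l + 1 <= h n by near: n; exact: (cvgry_ge hy).
by rewrite (le_trans _ (lerD h1 h2))//; rewrite le_eqVlt; apply/orP; left; apply/eqP; ring.
Unshelve. all: end_near. Qed.

(* The antiderivative is
   [gauss_cdf (a * om - b / om) + expR (4 * a * b) * gauss_cdf (- (a * om + b / om))]:
   both summands produce the same exponential factor, and the terms in [a]
   cancel. *)
Lemma cauchy_schlomilch (om dom : R -> R) (a b : R) (u v : nat -> R) :
  0 < a -> 0 < b ->
  (forall n, u n < v n) ->
  {homo u : n m / (n <= m)%N >-> m <= n} ->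
  {homo v : n m / (n <= m)%N >-> n <= m} ->
  (forall n x, u n <= x <= v n -> 0 < om x) ->
  (forall n x, u n <= x <= v n -> is_derive x 1 om (dom x)) ->
  (forall n x, u n <= x <= v n -> {for x, continuous dom}) ->
  (forall n x, u n <= x <= v n -> 0 <= dom x) ->
  (forall n, om (u n) = n.+2%:R^-1) -> (forall n, om (v n) = n.+2%:R) ->
  (\int[leb]_(x in \bigcup_n `[u n, v n]%classic)
     (2 * b * dom x / om x ^+ 2 * expR (- (a * om x - b / om x) ^+ 2))%:E =
   (Num.sqrt pi)%:E)%E.
Proof.
move=> a0 b0 uv nu nv om0 dom_ cdom dom0 omu omv.
pose F x := gauss_cdf (a * om x - b * (om x)^-1) +
  expR (4 * a * b) * gauss_cdf (- (a * om x + b * (om x)^-1)).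
have cn (k : R) : 0 < k -> k * n.+2%:R @[n --> \oo] --> +oo.
  move=> k0; apply/cvgryPge => A; near=> n.
  rewrite mulrC -ler_pdivrMr//; apply: (@le_trans _ _ n%:R); last by rewrite ler_nat -addn2 leq_addr.
  by near: n; exact: nbhs_infty_ger.
have cv : n.+2%:R^-1 @[n --> \oo] --> (0 : R).
  apply/gtr0_cvgV0; first exact: nearW.
  by under eq_fun do rewrite -[_%:R]mul1r; exact: cn.
have can := cn _ a0.
have cbn := cn _ b0.
have cav : a * n.+2%:R^-1 @[n --> \oo] --> (0 : R).
  by rewrite -(mulr0 a); apply: cvgM => //; exact: cvg_cst.
have cbv : b * n.+2%:R^-1 @[n --> \oo] --> (0 : R).
  by rewrite -(mulr0 b); apply: cvgM => //; exact: cvg_cst.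
rewrite -[Num.sqrt pi]subr0.
apply: (@ge0_FTC_bigcup _ F u v 0 (Num.sqrt pi)) => //.
- move=> n x xuv.
  have omx := om0 n x xuv.
  have dom1 := dom_ n x xuv.
  have omx0 : om x != 0 by rewrite gt_eqF.
  have dV := is_deriveV omx0 dom1.
  have d1 := is_derive_gauss_cdf (a * om x - b * (om x)^-1).
  have d2 := is_derive_gauss_cdf (- (a * om x + b * (om x)^-1)).
  rewrite /F; apply: is_derive_eq.
  rewrite /gauss_fun.
  have -> : expR (- (- (a * om x + b * (om x)^-1)) ^+ 2) =
      expR (- (a * om x - b / om x) ^+ 2) / expR (4 * a * b).
    by rewrite -expRN -expRD; congr expR; field.
  rewrite /GRing.scale /=.
  by field; rewrite omx0 gt_eqF// expR_gt0.
- move=> n x xuv.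
  have [dm _] := dom_ n x xuv.
  have co : {for x, continuous om} by exact/differentiable_continuous/derivable1_diffP.
  have cV : {for x, continuous (fun x => (om x)^-1)}.
    by apply: cvgV => //; rewrite gt_eqF// (om0 n).
  apply: cvgM.
    apply: cvgM; first by apply: cvgM; [exact: cvg_cst|exact: cdom xuv].
    under eq_fun do rewrite -exprVn expr2; rewrite -exprVn expr2.
    exact: cvgM.
  apply: (cvg_comp _ expR); last exact: continuous_expR.
  apply: cvgN; rewrite expr2; under eq_fun do rewrite expr2.
  by apply: cvgM; apply: cvgB; apply: cvgM => //; exact: cvg_cst.
- move=> n x xuv; rewrite mulr_ge0 ?expR_ge0// divr_ge0 ?sqr_ge0//.
  by rewrite mulr_ge0 ?(dom0 n)// mulr_ge0// ltW.
(* At the left endpoints [om] tends to 0, both arguments tend to [-oo], and [F] vanishes in the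
   limit. *)
- rewrite -[X in _ --> X](addr0 0) /F; under eq_fun do rewrite omu invrK.
  apply: cvgD.
    apply: gauss_cdf_cvgNy; under eq_fun do rewrite -opprB.
    apply/cvgNrNy; under eq_fun do rewrite addrC.
    by apply: (@cvgDry _ _ 0) => //; rewrite -oppr0; apply: cvgN.
  rewrite -(mulr0 (expR (4 * a * b))); apply: cvgM; first exact: cvg_cst.
  by apply: gauss_cdf_cvgNy; apply/cvgNrNy; exact: cvgDry cav cbn.
(* At the right endpoints [om] tends to [+oo]: the first argument tends to [+oo], the second to
   [-oo], so only the full Gaussian mass remains. *)
- rewrite -[X in _ --> X](addr0) /F; under eq_fun do rewrite omv.
  apply: cvgD.
    apply: gauss_cdf_cvgy; under eq_fun do rewrite addrC.
    by apply: (@cvgDry _ _ 0) => //; rewrite -oppr0; apply: cvgN.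
  rewrite -(mulr0 (expR (4 * a * b))); apply: cvgM; first exact: cvg_cst.
  apply: gauss_cdf_cvgNy; apply/cvgNrNy; under eq_fun do rewrite addrC.
  exact: cvgDry cbv can.
Unshelve. all: end_near. Qed.

End gauss.

(** * First passage densities of Brownian motion with drift *)

Section kernel.
Context {R : realType}.
Notation leb := (@lebesgue_measure R).

(** For positive [D] and [s], the normal density with mean [c * s] and variance [2 * D * s]: the
    [phi_s] of the overview. *)
Definition gauss_kernel (c D s y : R) : R :=
  (2 * Num.sqrt (pi * D * s))^-1 * expR (- ((y - c * s) ^+ 2 / (4 * D * s))).

Lemma gauss_kernel_ge0 c D s y : 0 <= gauss_kernel c D s y.
Proof. by rewrite mulr_ge0 ?expR_ge0// invr_ge0 mulr_ge0// sqrtr_ge0. Qed.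

Lemma invn_le (n m : nat) : (n <= m)%N -> m.+2%:R^-1 <= n.+2%:R^-1 :> R.
Proof. by move=> nm; rewrite lef_pV2 ?posrE// ler_nat !ltnS. Qed.

(** With positive drift, the level [x] is reached almost surely. Analytically, [om = Num.sqrt] turns
    the exponent into the square in [cauchy_schlomilch], with coefficients [c / (2 * Num.sqrt D)]
    and [x / (2 * Num.sqrt D)]. *)
Lemma integral_gauss_kernel (c D x : R) : 0 < c -> 0 < D -> 0 < x ->
  (\int[leb]_(s in `]0%R, +oo[) (x / s * gauss_kernel c D s x)%:E = 1)%E.
Proof.
move=> c0 D0 x0.
(* Square roots of the endpoints are the inverse of [n.+2] and [n.+2] itself; starting at 2 keeps
   [u n < 1 < v n] for every [n]. *)
pose u (n : nat) : R := (n.+2%:R^-1) ^+ 2.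
pose v (n : nat) : R := (n.+2%:R) ^+ 2.
have sD0 : 0 < Num.sqrt D by rewrite sqrtr_gt0.
have sp0 : 0 < Num.sqrt pi :> R by rewrite sqrtr_gt0 pi_gt0.
have uvs n s : u n <= s <= v n -> 0 < s.
  by move=> /andP[+ _]; apply: lt_le_trans; rewrite exprn_gt0.
have E : `]0, +oo[%classic = \bigcup_n `[u n, v n]%classic.
  apply/seteqP; split => s /=; rewrite in_itv /=; last first.
    by move=> [n _ /= H]; rewrite andbT; apply: (@uvs n).
  rewrite andbT => s0.
  pose n := (Num.trunc s + Num.trunc (s^-1))%N.
  have h1 : s <= n.+2%:R.
    by rewrite ltW// (lt_le_trans (truncnS_gt s))// ler_nat /n ltnS -addnS leq_addr.
  have h2 : s^-1 <= n.+2%:R.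
    by rewrite ltW// (lt_le_trans (truncnS_gt s^-1))// ler_nat /n ltnS -addSn leq_addl.
  have h3 : 1 <= n.+2%:R :> R by rewrite ler1n.
  exists n => //=; rewrite in_itv /= /u /v; apply/andP; split.
    rewrite exprVn invf_ple ?posrE ?exprn_gt0//.
    by rewrite (le_trans h2)// expr2 ler_peMl.
  by rewrite (le_trans h1)// expr2 ler_peMl.
have c1 := @cauchy_schlomilch R Num.sqrt (fun s => (2 * Num.sqrt s)^-1)
  (c / (2 * Num.sqrt D)) (x / (2 * Num.sqrt D)) u v.
rewrite -E in c1.
transitivity (\int[leb]_(s in `]0%R, +oo[) ((Num.sqrt pi)^-1%:E *
  (2 * (x / (2 * Num.sqrt D)) * (2 * Num.sqrt s)^-1 / (Num.sqrt s) ^+ 2 *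
   expR (- (c / (2 * Num.sqrt D) * Num.sqrt s - (x / (2 * Num.sqrt D)) / Num.sqrt s) ^+ 2))%:E))%E.
  apply: eq_integral => s; rewrite inE /= in_itv /= andbT => s0.
  rewrite -EFinM; congr EFin.
  have ss0 : 0 < Num.sqrt s by rewrite sqrtr_gt0.
  rewrite /gauss_kernel !sqrtrM ?mulr_ge0 ?pi_ge0 ?ltW//.
  have -> : (x - c * s) ^+ 2 / (4 * D * s) =
      (c / (2 * Num.sqrt D) * Num.sqrt s - (x / (2 * Num.sqrt D)) / Num.sqrt s) ^+ 2.
    rewrite -{1 2}[s](sqr_sqrtr (ltW s0)) -{1}[D](sqr_sqrtr (ltW D0)).
    by field; rewrite !gt_eqF.
  rewrite -{1}[s](sqr_sqrtr (ltW s0)).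
  by field; rewrite !gt_eqF.
rewrite ge0_integralZl_EFin//.
- rewrite [X in (_ * X)%E](_ : _ = (Num.sqrt pi)%:E); first by rewrite -EFinM mulVf ?gt_eqF.
  apply: c1 => //.
  + by rewrite divr_gt0// mulr_gt0.
  + by rewrite divr_gt0// mulr_gt0.
  + move=> n; rewrite /u /v exprVn.
    rewrite (@lt_trans _ _ 1)// ?invf_lt1 ?exprn_gt0// exprn_egt1 ?ltr1n//.
  + by move=> n m nm; rewrite /u ler_pXn2r ?nnegrE// invn_le.
  + by move=> n m nm; rewrite /v ler_pXn2r ?nnegrE// ler_nat !ltnS.
  + by move=> n s /uvs; rewrite sqrtr_gt0.
  + by move=> n s /uvs s0; exact: is_derive1_sqrt.
  + move=> n s /uvs s0; apply: cvgV; first by rewrite mulf_neq0// gt_eqF// sqrtr_gt0.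
    by apply: cvgM; [exact: cvg_cst|exact: sqrt_continuous].
  + by move=> n; rewrite /u sqrtr_sqr ger0_norm.
  + by move=> n; rewrite /v sqrtr_sqr ger0_norm.
- move=> s _; rewrite lee_fin mulr_ge0 ?expR_ge0// divr_ge0 ?sqr_ge0//.
  by rewrite !mulr_ge0 ?invr_ge0 ?mulr_ge0 ?sqrtr_ge0// ltW.
- apply/measurable_EFinP; apply: measurable_funTS.
  have ms := @measurable_sqrt R.
  have mi := measurableT_comp (@measurable_inv R) ms.
  apply: measurable_funM.
    apply: measurable_funM.
      apply: measurable_funM => //.
      apply: (measurableT_comp (@measurable_inv R)).
      exact: measurable_funM.
    apply: (measurableT_comp (@measurable_inv R)).
    exact: measurable_funX.
  apply: measurableT_comp => //; apply: measurableT_comp => //.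
  apply: measurable_funX; apply: measurable_funB; exact: measurable_funM.
Qed.

(** First passage decomposition: a path at [x + y] at time [u] has first hit [x] at some [s < u] and
    covers [y] in the remaining time. The substitution [om = Num.sqrt s / Num.sqrt (u - s)] reduces
    it to [cauchy_schlomilch]. *)
Lemma integral_conv_gauss_kernel (c D x y u : R) : 0 < D -> 0 < x -> 0 < y -> 0 < u ->
  (\int[leb]_(s in `]0%R, u[) (x / s * gauss_kernel c D s x * gauss_kernel c D (u - s) y)%:E =
   (gauss_kernel c D u (x + y))%:E)%E.
Proof.
move=> D0 x0 y0 u0.
(* [a n] solves [s / (u - s) = n.+2%:R ^- 2]; its mirror image [b n] gives the inverse ratio. *)
pose a (n : nat) : R := u / (1 + n.+2%:R ^+ 2).
pose b (n : nat) : R := u - a n.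
have sD0 : 0 < Num.sqrt D by rewrite sqrtr_gt0.
have su0 : 0 < Num.sqrt u by rewrite sqrtr_gt0.
have sp0 : 0 < Num.sqrt pi :> R by rewrite sqrtr_gt0 pi_gt0.
have N0 n : 0 < 1 + n.+2%:R ^+ 2 :> R by rewrite ltr_wpDl// exprn_gt0.
have a0 n : 0 < a n by rewrite divr_gt0.
have abs n s : a n <= s <= b n -> 0 < s < u.
  move=> /andP[h1 h2]; rewrite (lt_le_trans _ h1)//= (le_lt_trans h2)//.
  by rewrite /b ltrBlDr ltrDl.
have ba n : b n = n.+2%:R ^+ 2 * a n.
  by rewrite /b /a; field; rewrite gt_eqF.
have an n m : (n <= m)%N -> a m <= a n.
  move=> nm; rewrite /a ler_wpM2l ?(ltW u0)// lef_pV2 ?posrE// lerD2l.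
  by rewrite ler_pXn2r ?nnegrE// ler_nat !ltnS.
have E : `]0, u[%classic = \bigcup_n `[a n, b n]%classic.
  apply/seteqP; split => s /=; rewrite in_itv /=; last first.
    by move=> [n _ /= H]; apply: (@abs n).
  move=> /andP[s0 su].
  have us0 : 0 < u - s by rewrite subr_gt0.
  pose n := (Num.trunc (u / s) + Num.trunc (u / (u - s)))%N.
  have h1 : u / s <= n.+2%:R.
    by rewrite ltW// (lt_le_trans (truncnS_gt (u / s)))// ler_nat /n ltnS -addnS leq_addr.
  have h2 : u / (u - s) <= n.+2%:R.
    by rewrite ltW// (lt_le_trans (truncnS_gt (u / (u - s))))// ler_nat /n ltnS -addSn leq_addl.
  have h3 : n.+2%:R <= 1 + n.+2%:R ^+ 2 :> R.
    have : 1 <= n.+2%:R :> R by rewrite ler1n.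
    by move: (n.+2%:R : R) => z z1; nra.
  exists n => //=; rewrite in_itv /= /b /a; apply/andP; split.
    by rewrite ler_pdivrMr// mulrC -ler_pdivrMr// (le_trans h1).
  rewrite lerBrDr -lerBrDl ler_pdivrMr// mulrC -ler_pdivrMr// (le_trans h2)//.
pose A (s : R) := Num.sqrt s. pose B (s : R) := Num.sqrt (u - s).
have AB0 s : 0 < s < u -> (0 < A s) * (0 < B s).
  by move=> /andP[s0 su]; rewrite !sqrtr_gt0 subr_gt0.
have c1 := @cauchy_schlomilch R (fun s => A s * (B s)^-1)
  (fun s => u * (2 * A s * B s ^+ 3)^-1)
  (y / (2 * Num.sqrt D * Num.sqrt u)) (x / (2 * Num.sqrt D * Num.sqrt u)) a b.
rewrite -E in c1.
transitivity (\int[leb]_(s in `]0%R, u[) (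
  (expR (- ((x + y - c * u) ^+ 2 / (4 * D * u))) /
    (2 * pi * Num.sqrt D * Num.sqrt u))%:E *
  (2 * (x / (2 * Num.sqrt D * Num.sqrt u)) * (u * (2 * A s * B s ^+ 3)^-1) / (A s * (B s)^-1) ^+ 2 *
   expR (- (y / (2 * Num.sqrt D * Num.sqrt u) * (A s * (B s)^-1) -
            (x / (2 * Num.sqrt D * Num.sqrt u)) / (A s * (B s)^-1)) ^+ 2))%:E))%E.
  apply: eq_integral => s; rewrite inE /= in_itv /= => sab.
  have [As0 Bs0] := AB0 _ sab; move: sab => /andP[s0 su].
  have us0 : 0 < u - s by rewrite subr_gt0.
  rewrite -EFinM; congr EFin.
  rewrite /gauss_kernel !sqrtrM ?mulr_ge0 ?pi_ge0 ?(ltW us0) ?(ltW D0)//.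
  rewrite -/(A s) -/(B s).
  have sA : A s ^+ 2 = s by rewrite sqr_sqrtr// ltW.
  have sB : B s ^+ 2 = u - s by rewrite sqr_sqrtr// ltW.
  have uE : u = A s ^+ 2 + B s ^+ 2 by rewrite sA sB addrC subrK.
  have DE : D = Num.sqrt D ^+ 2 by rewrite sqr_sqrtr// ltW.
  have suE : Num.sqrt u ^+ 2 = u by rewrite sqr_sqrtr// ltW.
  have piE : pi = Num.sqrt pi ^+ 2 :> R by rewrite sqr_sqrtr// pi_ge0.
  set W := (X in expR (- X ^+ 2)).
  have WE : W ^+ 2 = (y * s - x * (u - s)) ^+ 2 / (4 * D * u * s * (u - s)).
    have -> : W = (y * s - x * (u - s)) / (2 * Num.sqrt D * Num.sqrt u * A s * B s).
      by rewrite /W -sB -[in y * s]sA; field; rewrite !gt_eqF.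
    rewrite expr_div_n !exprMn sA sB suE -DE; congr (_ / _); ring.
  (* Completing the square: the two exponents add up to the exponent at [x + y] and time [u] plus
     [W ^+ 2], from which the drift has disappeared. *)
  have e : expR (- ((x - c * s) ^+ 2 / (4 * D * s))) *
      expR (- ((y - c * (u - s)) ^+ 2 / (4 * D * (u - s)))) =
      expR (- ((x + y - c * u) ^+ 2 / (4 * D * u))) * expR (- W ^+ 2).
    rewrite -!expRD WE; congr expR.
    by field; rewrite !gt_eqF.
  set e1 := expR _ in e *; set e2 := expR _ in e *; set e3 := expR _ in e *; set e4 := expR _ in e *.
  set k1 := (2 * _)^-1; set k2 := (2 * _)^-1.
  have -> : x / s * (k1 * e1) * (k2 * e2) = x / s * k1 * k2 * (e1 * e2) by ring.
  rewrite e; have E2 (A0 C : R) : e3 / A0 * (C * e4) = C / A0 * (e3 * e4) by ring.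
  rewrite E2 /k1 /k2; congr (_ * _).
  rewrite -{1}sA -[in u / (2 * A s * _)]suE [in RHS]piE.
  by field; rewrite !gt_eqF.
rewrite ge0_integralZl_EFin//.
- rewrite [X in (_ * X)%E](_ : _ = (Num.sqrt pi)%:E); last first.
    apply: c1 => //.
    + by rewrite divr_gt0// !mulr_gt0.
    + by rewrite divr_gt0// !mulr_gt0.
    + by move=> n; rewrite ba ltr_pMl// exprn_egt1 ?ltr1n.
    + by move=> n m nm; rewrite /b lerD2l lerN2; exact: an.
    + by move=> n s /abs /AB0[]; exact: divr_gt0.
    + move=> n s /abs sab; have [As0 Bs0] := AB0 _ sab; move: sab => /andP[s0 su].
      have us0 : 0 < u - s by rewrite subr_gt0.
      have dA : is_derive s 1 A (2 * A s)^-1 by exact: is_derive1_sqrt.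
      have du : is_derive s 1 (fun s => u - s) (-1).
        by apply: is_derive_eq; rewrite add0r mul1r.
      have dB : is_derive s 1 B ((2 * B s)^-1 * -1).
        exact: (@is_derive1_comp R Num.sqrt (fun s => u - s) s _ _ (is_derive1_sqrt us0) du).
      have Bn0 : B s != 0 by rewrite gt_eqF.
      have dV := is_deriveV Bn0 dB.
      apply: is_derive_eq; rewrite /GRing.scale /=.
      have -> : u = A s ^+ 2 + B s ^+ 2 by rewrite !sqr_sqrtr ?ltW// addrC subrK.
      by field; rewrite !gt_eqF.
    + move=> n s /abs sab; have [As0 Bs0] := AB0 _ sab.
      have cA : {for s, continuous A} by exact: sqrt_continuous.
      have cB : {for s, continuous B}.
        apply: (cvg_comp (fun s => u - s) Num.sqrt); last exact: sqrt_continuous.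
        by apply: cvgB; [exact: cvg_cst|exact: cvg_id].
      apply: cvgM; first exact: cvg_cst.
      apply: cvgV; first by rewrite !mulf_neq0 ?expf_neq0 ?gt_eqF.
      apply: cvgM; first by apply: cvgM; [exact: cvg_cst|].
      under eq_fun do rewrite !exprS expr0; rewrite !exprS expr0.
      by do !apply: cvgM => //; exact: cvg_cst.
    + move=> n s /abs sab; have [As0 Bs0] := AB0 _ sab.
      by rewrite mulr_ge0 ?invr_ge0 ?mulr_ge0 ?exprn_ge0// ltW.
    + move=> n; have An0 : 0 < A (a n) by rewrite sqrtr_gt0.
      rewrite /B -/(b n) ba sqrtrM ?sqr_ge0// sqrtr_sqr ger0_norm// -/(A (a n)).
      by field; rewrite !gt_eqF.
    + move=> n; have An0 : 0 < A (a n) by rewrite sqrtr_gt0.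
      rewrite /B {2}/b opprB addrC subrK -/(A (a n)) /A ba sqrtrM ?sqr_ge0//.
      by rewrite sqrtr_sqr ger0_norm// -/(A (a n)); field; rewrite !gt_eqF.
  rewrite -EFinM; congr EFin; rewrite /gauss_kernel !sqrtrM ?mulr_ge0 ?pi_ge0 ?ltW//.
  have piE : pi = Num.sqrt pi ^+ 2 :> R by rewrite sqr_sqrtr// pi_ge0.
  by rewrite {1}piE; field; rewrite !gt_eqF.
- move=> s /=; rewrite in_itv /= => sab; have [As0 Bs0] := AB0 _ sab.
  rewrite lee_fin mulr_ge0 ?expR_ge0// divr_ge0 ?sqr_ge0//.
  by rewrite !mulr_ge0 ?invr_ge0 ?divr_ge0 ?mulr_ge0 ?exprn_ge0 ?ltW.
- apply/measurable_EFinP; apply: measurable_funTS.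
  have mA : measurable_fun setT A by exact: measurable_sqrt.
  have mB : measurable_fun setT B.
    by apply: (measurableT_comp (@measurable_sqrt R)); exact: measurable_funB.
  have mAB : measurable_fun setT (fun s => A s / B s).
    by apply: measurable_funM => //; exact: (measurableT_comp (@measurable_inv R)).
  apply: measurable_funM.
    apply: measurable_funM.
      apply: measurable_funM => //; apply: measurable_funM => //.
      apply: (measurableT_comp (@measurable_inv R)).
      by apply: measurable_funM; [exact: measurable_funM|exact: measurable_funX].
    apply: (measurableT_comp (@measurable_inv R)).
    exact: measurable_funX.
  apply: measurableT_comp => //; apply: measurableT_comp => //.
  apply: measurable_funX; apply: measurable_funB; apply: measurable_funM => //.
  exact: (measurableT_comp (@measurable_inv R)).
- by rewrite divr_ge0 ?expR_ge0// !mulr_ge0 ?pi_ge0 ?sqrtr_ge0.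
Qed.

End kernel.

(** * Discounted time moments of the Gaussian kernel *)

Section kernel_moment.
Context {R : realType}.
Notation leb := (@lebesgue_measure R).
Notation MR := (measurableTypeR R).
Local Open Scope ereal_scope.

Lemma measurable_add2 : measurable_fun setT (fun z : MR * MR => z.1 + z.2 : MR)%R.
Proof. by apply: measurable_funD; [exact: measurable_fst|exact: measurable_snd]. Qed.

Lemma measurable_sub2 : measurable_fun setT (fun z : MR * MR => z.1 - z.2 : MR)%R.
Proof. by apply: measurable_funB; [exact: measurable_fst|exact: measurable_snd]. Qed.

Lemma measurable_comp_fst (f : MR -> \bar R) : measurable_fun setT f ->
  measurable_fun setT (fun z : MR * MR => f z.1).
Proof. by move=> mf; exact: (measurableT_comp mf measurable_fst). Qed.

Lemma measurable_comp_snd (f : MR -> \bar R) : measurable_fun setT f ->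
  measurable_fun setT (fun z : MR * MR => f z.2).
Proof. by move=> mf; exact: (measurableT_comp mf measurable_snd). Qed.

(** Tonelli brings the integral over [u] inside, and the translation [u = t + s] separates [f] from
    [g]. *)
Lemma integral_conv (F f g : MR -> \bar R) :
  measurable_fun setT F -> measurable_fun setT f -> measurable_fun setT g ->
  (forall x, 0 <= F x) -> (forall x, 0 <= f x) -> (forall x, 0 <= g x) ->
  \int[leb]_u (F u * \int[leb]_s (f (u - s)%R * g s)) =
  \int[leb]_s (g s * \int[leb]_t (F (t + s)%R * f t)).
Proof.
move=> mF mf mg F0 f0 g0.
transitivity (\int[leb]_u \int[leb]_s (F u * (f (u - s)%R * g s))).
  apply: eq_integral => u _; rewrite ge0_integralZl//.
  - apply: emeasurable_funM => //; apply: measurableT_comp => //.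
    exact: measurable_funB.
  - by move=> s _; rewrite mule_ge0.
rewrite (fubini_tonelli (fun z : MR * MR => F z.1 * (f (z.1 - z.2)%R * g z.2)))/=; first last.
- by move=> z; rewrite !mule_ge0.
- apply: emeasurable_funM; first exact: measurable_comp_fst.
  apply: emeasurable_funM; last exact: measurable_comp_snd.
  exact: (measurableT_comp mf measurable_sub2).
apply: eq_integral => s _.
rewrite -[LHS](integral_shift s); first last.
- by move=> x; rewrite !mule_ge0.
- apply: emeasurable_funM => //; apply: emeasurable_funM => //.
  by apply: measurableT_comp => //; exact: measurable_funB.
rewrite -ge0_integralZl//; first last.
- by move=> t _; rewrite mule_ge0.
- by apply: emeasurable_funM => //; apply: measurableT_comp => //; exact: measurable_funD.
by apply: eq_integral => t _; rewrite addrK muleA [RHS]muleC.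
Qed.

Variables (q c D : R).
Hypothesis D0 : (0 < D)%R.

(* [s ^+ n / s] stands for the power [n - 1] of [s], which is [s^-1] for [n = 0]. *)
Definition moment_kernel (n : nat) (y s : R) : R :=
  if (0 < s)%R then (expR (- (q * s)) * s ^+ n / s * gauss_kernel c D s y)%R else 0%R.

Lemma moment_kernel_ge0 n y s : (0 <= moment_kernel n y s)%R.
Proof.
rewrite /moment_kernel; case: ifP => // s0.
by rewrite !mulr_ge0 ?expR_ge0 ?invr_ge0 ?gauss_kernel_ge0 ?exprn_ge0// ltW.
Qed.

Lemma measurable_gauss_kernel d (T : measurableType d) (f g : T -> R) :
  measurable_fun setT f -> measurable_fun setT g ->
  measurable_fun setT (fun z => gauss_kernel c D (f z) (g z)).
Proof.
move=> mf mg; have mi := @measurable_inv R.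
apply: measurable_funM.
  apply: (measurableT_comp mi); apply: measurable_funM => //.
  apply: (measurableT_comp (@measurable_sqrt R)).
  exact: measurable_funM.
apply: measurableT_comp => //; apply: measurableT_comp => //.
apply: measurable_funM.
  by apply: measurable_funX; apply: measurable_funB => //; exact: measurable_funM.
by apply: (measurableT_comp mi); exact: measurable_funM.
Qed.

Lemma measurable_moment_kernel d (T : measurableType d) n (f g : T -> R) :
  measurable_fun setT f -> measurable_fun setT g ->
  measurable_fun setT (fun z => moment_kernel n (f z) (g z)).
Proof.
move=> mf mg; apply: measurable_fun_ifT => //; first exact: measurable_fun_ltr.
apply: measurable_funM; last exact: measurable_gauss_kernel.
apply: measurable_funM; last exact: (measurableT_comp (@measurable_inv R)).
apply: measurable_funM; last exact: measurable_funX.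
apply: measurableT_comp => //; apply: measurableT_comp => //.
exact: measurable_funM.
Qed.

Definition kernel_moment (n : nat) (y : R) : \bar R := \int[leb]_s (moment_kernel n y s)%:E.

Lemma kernel_moment_ge0 n y : 0 <= kernel_moment n y.
Proof. by apply: integral_ge0 => s _; rewrite lee_fin moment_kernel_ge0. Qed.

Lemma measurable_kernel_moment n : measurable_fun setT (kernel_moment n : MR -> \bar R).
Proof.
apply: (measurable_fun_fubini_tonelli_F (fun z : MR * MR => (moment_kernel n z.1 z.2)%:E)).
  by apply/measurable_EFinP; apply: measurable_moment_kernel;
    [exact: measurable_fst|exact: measurable_snd].
by move=> z; rewrite lee_fin moment_kernel_ge0.
Qed.

(* Summing the binomial expansion of [(t + s) ^+ m] reduces this to
   [integral_conv_gauss_kernel]. *)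
Lemma kernel_moment_conv (m : nat) (x y : R) : (0 < x)%R -> (0 < y)%R ->
  \sum_(j < m.+1) 'C(m, j)%:R%:E * (kernel_moment j.+1 x * (y%:E * kernel_moment (m - j)%N y)) =
  kernel_moment m.+1 (x + y)%R.
Proof.
move=> x0 y0.
(* [F] is the time weight of the moment of order [m.+1], [f] the density at [x], and [g] the first
   passage density over [y]; extension by 0 lets the time convolution run over the whole line. *)
pose F (u : R) := (if 0 < u then expR (- (q * u)) * u ^+ m else 0)%R.
pose f (t : R) := (if 0 < t then gauss_kernel c D t x else 0)%R.
pose g (s : R) := (if 0 < s then y / s * gauss_kernel c D s y else 0)%R.
have F0 u : (0 <= F u)%R.
  by rewrite /F; case: ifP => // u0; rewrite mulr_ge0 ?expR_ge0 ?exprn_ge0// ltW.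
have f0 u : (0 <= f u)%R by rewrite /f; case: ifP => // u0; exact: gauss_kernel_ge0.
have g0 u : (0 <= g u)%R.
  by rewrite /g; case: ifP => // u0; rewrite mulr_ge0 ?gauss_kernel_ge0 ?divr_ge0// ltW.
have mF : measurable_fun setT (EFin \o F).
  apply/measurable_EFinP; apply: measurable_fun_ifT => //; first exact: measurable_fun_ltr.
  apply: measurable_funM; last exact: measurable_funX.
  by apply: measurableT_comp => //; apply: measurableT_comp => //; exact: measurable_funM.
have mf : measurable_fun setT (EFin \o f).
  apply/measurable_EFinP; apply: measurable_fun_ifT => //; first exact: measurable_fun_ltr.
  exact: measurable_gauss_kernel.
have mg : measurable_fun setT (EFin \o g).
  apply/measurable_EFinP; apply: measurable_fun_ifT => //; first exact: measurable_fun_ltr.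
  apply: measurable_funM; last exact: measurable_gauss_kernel.
  apply: measurable_funM => //; exact: measurable_inv.
have -> : kernel_moment m.+1 (x + y)%R =
    \int[leb]_u ((F u)%:E * \int[leb]_s ((f (u - s)%R)%:E * (g s)%:E)).
  apply: eq_integral => u _; rewrite /moment_kernel /F; case: ifPn => u0; last by rewrite mul0e.
  have -> : \int[leb]_s ((f (u - s)%R)%:E * (g s)%:E) = (gauss_kernel c D u (x + y))%:E.
    rewrite addrC -(integral_conv_gauss_kernel c D0 y0 x0 u0) [RHS]integral_mkcond.
    apply: eq_integral => s _; rewrite patchE mem_setE in_itv /= /f /g subr_gt0.
    rewrite -EFinM; case: (ltP 0%R s) => s0; case: (ltP s u) => su //=; rewrite ?mulr0 ?mul0r//.
    by rewrite mulrC.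
  by rewrite -EFinM; congr EFin; rewrite exprSr; field; rewrite gt_eqF.
rewrite (@integral_conv (EFin \o F) (EFin \o f) (EFin \o g))//.
have mk n z : measurable_fun setT (fun s : MR => (moment_kernel n z s)%:E).
  by apply/measurable_EFinP; exact: measurable_moment_kernel.
transitivity (\sum_(j < m.+1) \int[leb]_s \int[leb]_t
  (('C(m, j)%:R * (moment_kernel j.+1 x t * (y * moment_kernel (m - j)%N y s))))%:E).
  apply: eq_bigr => j _.
  rewrite [kernel_moment (m - j)%N y]/kernel_moment -ge0_integralZl//; first last.
  - by rewrite lee_fin ltW.
  - by move=> s _; rewrite lee_fin moment_kernel_ge0.
  rewrite -ge0_integralZl//; first last.
  - exact: kernel_moment_ge0.
  - by move=> s _; rewrite mule_ge0// lee_fin ?moment_kernel_ge0 ?ltW.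
  - exact: emeasurable_funM.
  rewrite -ge0_integralZl//; first last.
  - by move=> s _; rewrite !mule_ge0 ?kernel_moment_ge0// lee_fin ?moment_kernel_ge0 ?ltW.
  - by apply: emeasurable_funM => //; exact: emeasurable_funM.
  apply: eq_integral => s _.
  rewrite /kernel_moment -ge0_integralZr//; first last.
  - by rewrite mule_ge0// lee_fin ?moment_kernel_ge0 ?ltW.
  - by move=> t _; rewrite lee_fin moment_kernel_ge0.
  rewrite -ge0_integralZl//; first last.
  - by move=> t _; rewrite !mule_ge0// lee_fin ?moment_kernel_ge0 ?ltW.
  - by apply: emeasurable_funM.
have S0 (j : 'I_m.+1) s t :
    (0 <= 'C(m, j)%:R * (moment_kernel j.+1 x t * (y * moment_kernel (m - j)%N y s)))%R.
  by rewrite !mulr_ge0 ?moment_kernel_ge0// ltW.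
rewrite -ge0_integral_sum//; first last.
- by move=> j s _; apply: integral_ge0 => t _; rewrite lee_fin.
- move=> j.
  apply: (measurable_fun_fubini_tonelli_F (fun z : MR * MR =>
    ('C(m, j)%:R * (moment_kernel j.+1 x z.2 * (y * moment_kernel (m - j)%N y z.1)))%:E)).
    apply/measurable_EFinP; apply: measurable_funM => //; apply: measurable_funM.
      by apply: measurable_moment_kernel => //; exact: measurable_snd.
    by apply: measurable_funM => //; apply: measurable_moment_kernel => //; exact: measurable_fst.
  by move=> z; rewrite lee_fin.
apply: eq_integral => s _.
have ms (j : 'I_m.+1) : measurable_fun setT (fun t : MR =>
    ('C(m, j)%:R * (moment_kernel j.+1 x t * (y * moment_kernel (m - j)%N y s)))%:E).
  apply/measurable_EFinP; apply: measurable_funM => //; apply: measurable_funM => //.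
  exact: measurable_moment_kernel.
rewrite -ge0_integral_sum//; last by move=> j t _; rewrite lee_fin.
rewrite -ge0_integralZl//; first last.
- by rewrite /= lee_fin.
- by move=> t _; rewrite mule_ge0// lee_fin.
- apply: emeasurable_funM => //=; apply: (measurableT_comp mF); exact: measurable_funD.
apply: eq_integral => t _.
rewrite sumEFin -!EFinM; congr EFin.
rewrite /moment_kernel /F /f /g /=.
case: (ltP 0%R t) => t0; last first.
  by rewrite !mulr0; apply: big1 => j _; rewrite mul0r mulr0.
case: (ltP 0%R s) => s0; last first.
  by rewrite mul0r; apply: big1 => j _; rewrite !mulr0.
rewrite addr_gt0// [(t + s)%R]addrC exprDn mulr_sumr mulr_suml mulr_sumr.
apply: eq_bigr => j _.
have jm : (j <= m)%N by rewrite -ltnS.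
rewrite mulrDr opprD expRD exprS -mulr_natl.
by field; rewrite !gt_eqF.
Qed.
End kernel_moment.

(** * Expectations over sums of independent claims *)

Section shiftop.
Context {R : realType}.
Notation leb := (@lebesgue_measure R).
Notation MR := (measurableTypeR R).
Local Open Scope ereal_scope.

(** The standing condition under which Tonelli and monotone convergence apply to values that may be
    infinite. *)
Definition mge0 (f : R -> \bar R) : Prop :=
  measurable_fun setT (f : MR -> \bar R) /\ forall x, 0 <= f x.

Lemma mge0D f g : mge0 f -> mge0 g -> mge0 (f \+ g).
Proof.
move=> [mf f0] [mg g0]; split; first exact: emeasurable_funD.
by move=> x; rewrite adde_ge0.
Qed.

Lemma mge0M f g : mge0 f -> mge0 g -> mge0 (f \* g).
Proof.
move=> [mf f0] [mg g0]; split; first exact: emeasurable_funM.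
by move=> x; rewrite mule_ge0.
Qed.

Lemma mge0_cst k : 0 <= k -> mge0 (fun=> k).
Proof. by []. Qed.

Lemma mge0_sum (I : Type) (s : seq I) (f : I -> R -> \bar R) :
  (forall i, mge0 (f i)) -> mge0 (fun x => \sum_(i <- s) f i x).
Proof.
move=> mf; split; first by apply: emeasurable_sum => i; exact: (mf i).1.
by move=> x; apply: sume_ge0 => i _; exact: (mf i).2.
Qed.

Lemma mge0_nneseries (f : nat -> R -> \bar R) :
  (forall i, mge0 (f i)) -> mge0 (fun x => \sum_(0 <= i <oo) f i x).
Proof.
move=> mf; split.
  by apply: ge0_emeasurable_sum => [i x _ _|i _]; [exact: (mf i).2|exact: (mf i).1].
by move=> x; apply: nneseries_ge0 => i _ _; exact: (mf i).2.
Qed.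

Lemma mge0_shift (b : R) f : mge0 f -> mge0 (fun y => f (b + y)%R).
Proof.
move=> [mf f0]; split => //; apply: (measurableT_comp mf).
exact: measurable_funD.
Qed.

Lemma mge0_EFin (f : R -> R) : measurable_fun setT f -> (forall x, 0 <= f x)%R ->
  mge0 (EFin \o f).
Proof. by move=> mf f0; split; [exact/measurable_EFinP|move=> x; rewrite lee_fin]. Qed.

(* For [a] the density of [X], this is the expectation of [f (x + X)]; all
   expectations over sums of claims are iterates of it. *)
Definition shiftop (a : R -> R) (f : R -> \bar R) (x : R) : \bar R :=
  \int[leb]_z ((a z)%:E * f (x + z)%R).

Section weight.
Variable a : R -> R.
Hypotheses (ma : measurable_fun setT a) (a0 : forall x, (0 <= a x)%R).

Let mge0a : mge0 (EFin \o a) := mge0_EFin ma a0.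

Lemma mge0_shiftop f : mge0 f -> mge0 (shiftop a f).
Proof.
move=> mf; split; last first.
  move=> x; apply: integral_ge0 => z _.
  by apply: (mge0M mge0a (mge0_shift x mf)).2.
apply: (measurable_fun_fubini_tonelli_F
  (fun z : MR * MR => (a z.2)%:E * f (z.1 + z.2)%R)).
  apply: emeasurable_funM; first exact: (measurable_comp_snd mge0a.1).
  exact: (measurableT_comp mf.1 measurable_add2).
by move=> z; rewrite mule_ge0 ?lee_fin//; exact: mf.2.
Qed.

Lemma mge0_iter_shiftop f n : mge0 f -> mge0 (iter n (shiftop a) f).
Proof. by move=> mf; elim: n => //= n; exact: mge0_shiftop. Qed.

Lemma le_shiftop f g x : mge0 f -> mge0 g ->
  (forall z, a z != 0%R -> f (x + z)%R <= g (x + z)%R) ->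
  shiftop a f x <= shiftop a g x.
Proof.
move=> mf mg fg; have mf' := mge0M mge0a (mge0_shift x mf).
have mg' := mge0M mge0a (mge0_shift x mg).
apply: ge0_le_integral => //.
- by move=> z _; exact: mf'.2.
- exact: mf'.1.
- exact: mg'.1.
- move=> z _; have [->|az] := eqVneq (a z) 0%R; first by rewrite !mul0e.
  by rewrite lee_wpmul2l ?lee_fin// fg.
Qed.

Lemma eq_shiftop f g x : mge0 f -> mge0 g ->
  (forall z, a z != 0%R -> f (x + z)%R = g (x + z)%R) ->
  shiftop a f x = shiftop a g x.
Proof.
move=> mf mg fg; apply: eq_integral => z _.
have [->|az] := eqVneq (a z) 0%R; first by rewrite !mul0e.
by rewrite fg.
Qed.

Lemma shiftopD f g x : mge0 f -> mge0 g ->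
  shiftop a (f \+ g) x = shiftop a f x + shiftop a g x.
Proof.
move=> mf mg; have mf' := mge0M mge0a (mge0_shift x mf).
have mg' := mge0M mge0a (mge0_shift x mg).
rewrite /shiftop -ge0_integralD//.
- by apply: eq_integral => z _; rewrite ge0_muleDr//; [exact: mf.2|exact: mg.2].
- by move=> z _; exact: mf'.2.
- exact: mf'.1.
- by move=> z _; exact: mg'.2.
- exact: mg'.1.
Qed.

Lemma shiftopZ k f x : 0 <= k -> mge0 f ->
  shiftop a (fun y => k * f y) x = k * shiftop a f x.
Proof.
move=> k0 mf; have mf' := mge0M mge0a (mge0_shift x mf).
rewrite /shiftop -ge0_integralZl//.
- by apply: eq_integral => z _; rewrite muleCA.
- exact: mf'.1.
- by move=> z _; exact: mf'.2.
Qed.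

Lemma shiftop_sum (I : Type) (s : seq I) (f : I -> R -> \bar R) x :
  (forall i, mge0 (f i)) ->
  shiftop a (fun y => \sum_(i <- s) f i y) x = \sum_(i <- s) shiftop a (f i) x.
Proof.
move=> mf; have mf' i := mge0M mge0a (mge0_shift x (mf i)).
rewrite /shiftop -ge0_integral_sum//.
- apply: eq_integral => z _; rewrite ge0_sume_distrr//.
  by move=> i _; exact: (mf i).2.
- by move=> i; exact: (mf' i).1.
- by move=> i z _; exact: (mf' i).2.
Qed.

Lemma shiftop_nneseries (f : nat -> R -> \bar R) x : (forall i, mge0 (f i)) ->
  shiftop a (fun y => \sum_(0 <= i <oo) f i y) x =
  \sum_(0 <= i <oo) shiftop a (f i) x.
Proof.
move=> mf; have mf' i := mge0M mge0a (mge0_shift x (mf i)).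
rewrite /shiftop -integral_nneseries//.
- apply: eq_integral => z _; rewrite nneseriesZl//.
  by move=> i _; exact: (mf i).2.
- by move=> i; exact: (mf' i).1.
- by move=> i z _; exact: (mf' i).2.
Qed.

Lemma shiftop_shift (b : R) f : shiftop a (fun y => f (b + y)%R) = (fun x => shiftop a f (b + x)%R).
Proof. by apply/funext => x; apply: eq_integral => z _; rewrite addrA. Qed.

Lemma iter_shiftop_shift (b : R) f n :
  iter n (shiftop a) (fun y => f (b + y)%R) = (fun x => iter n (shiftop a) f (b + x)%R).
Proof. by elim: n => //= n ->; rewrite shiftop_shift. Qed.

Lemma iter_shiftopZ k f n : 0 <= k -> mge0 f ->
  iter n (shiftop a) (fun y => k * f y) = (fun x => k * iter n (shiftop a) f x).
Proof.
move=> k0 mf; elim: n => //= n ->; apply/funext => x.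
by rewrite shiftopZ//; exact: mge0_iter_shiftop.
Qed.

Lemma iter_shiftopD f g n : mge0 f -> mge0 g ->
  iter n (shiftop a) (f \+ g) = iter n (shiftop a) f \+ iter n (shiftop a) g.
Proof.
move=> mf mg; elim: n => //= n ->; apply/funext => x.
by rewrite shiftopD//; exact: mge0_iter_shiftop.
Qed.

Lemma iter_shiftop_sum (I : Type) (s : seq I) (f : I -> R -> \bar R) n :
  (forall i, mge0 (f i)) ->
  iter n (shiftop a) (fun y => \sum_(i <- s) f i y) =
  (fun x => \sum_(i <- s) iter n (shiftop a) (f i) x).
Proof.
move=> mf; elim: n => //= n ->; apply/funext => x.
by rewrite shiftop_sum// => i; exact: mge0_iter_shiftop.
Qed.

Lemma iter_shiftop_nneseries (f : nat -> R -> \bar R) n : (forall i, mge0 (f i)) ->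
  iter n (shiftop a) (fun y => \sum_(0 <= i <oo) f i y) =
  (fun x => \sum_(0 <= i <oo) iter n (shiftop a) (f i) x).
Proof.
move=> mf; elim: n => //= n ->; apply/funext => x.
by rewrite shiftop_nneseries// => i; exact: mge0_iter_shiftop.
Qed.

End weight.

(** Two independent claims may be added in either order: this is Tonelli. *)
Lemma shiftopC (a b : R -> R) f :
  measurable_fun setT a -> (forall x, 0 <= a x)%R ->
  measurable_fun setT b -> (forall x, 0 <= b x)%R -> mge0 f ->
  shiftop a (shiftop b f) = shiftop b (shiftop a f).
Proof.
move=> ma a0 mb b0 mf; apply/funext => x.
have ma' := mge0_EFin ma a0; have mb' := mge0_EFin mb b0.
transitivity (\int[leb]_z \int[leb]_y ((a z)%:E * ((b y)%:E * f (x + z + y)%R))).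
  apply: eq_integral => z _; rewrite ge0_integralZl ?lee_fin//.
    exact: (mge0M mb' (mge0_shift (x + z) mf)).1.
  by move=> y _; exact: (mge0M mb' (mge0_shift (x + z) mf)).2.
rewrite (fubini_tonelli (fun z : MR * MR =>
  (a z.1)%:E * ((b z.2)%:E * f (x + z.1 + z.2)%R)))/=; first last.
- by move=> z; rewrite !mule_ge0 ?lee_fin//; exact: mf.2.
- apply: emeasurable_funM; first exact: (measurable_comp_fst ma'.1).
  apply: emeasurable_funM; first exact: (measurable_comp_snd mb'.1).
  apply: (measurableT_comp mf.1); apply: measurable_funD; last exact: measurable_snd.
  by apply: measurable_funD => //; exact: measurable_fst.
apply: eq_integral => y _; rewrite -ge0_integralZl ?lee_fin//; first last.
- by move=> z _; exact: (mge0M ma' (mge0_shift (x + y) mf)).2.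
- exact: (mge0M ma' (mge0_shift (x + y) mf)).1.
by apply: eq_integral => z _; rewrite muleCA addrAC.
Qed.

Section positive_weight.
Variable a : R -> R.
Hypotheses (ma : measurable_fun setT a) (a0 : forall x, (0 <= a x)%R).
Hypothesis aneg : forall x, (x <= 0)%R -> a x = 0%R.

Let apos z : a z != 0%R -> (0 < z)%R.
Proof. by apply: contra_neqT; rewrite -leNgt => /aneg. Qed.

(** The size-biased weight: its operator yields the expectation of [X f(x + X)]. The absolute value
    keeps it nonnegative on the whole line. *)
Let Ua (z : R) : R := (`|z| * a z)%R.

Let mUa : measurable_fun setT Ua.
Proof. exact: measurable_funM. Qed.

Let Ua0 z : (0 <= Ua z)%R.
Proof. by rewrite mulr_ge0. Qed.

(** At least one positive claim is added, so even from [x = 0] the functions are evaluated only on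
    the positive half-line. *)
Lemma le_iter_shiftop f g n x : (0 <= x)%R -> mge0 f -> mge0 g ->
  (forall y, (0 < y)%R -> f y <= g y) ->
  iter n.+1 (shiftop a) f x <= iter n.+1 (shiftop a) g x.
Proof.
move=> x0 mf mg fg; elim: n x x0 => [|n IH] x x0.
  by apply: le_shiftop => // z /apos z0; apply: fg; rewrite ltr_wpDl.
rewrite iterS [in leRHS]iterS; apply: le_shiftop => //.
- exact: mge0_iter_shiftop.
- exact: mge0_iter_shiftop.
by move=> z /apos z0; apply: IH; rewrite addr_ge0// ltW.
Qed.

Lemma eq_iter_shiftop f g n x : (0 <= x)%R -> mge0 f -> mge0 g ->
  (forall y, (0 < y)%R -> f y = g y) ->
  iter n.+1 (shiftop a) f x = iter n.+1 (shiftop a) g x.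
Proof.
move=> x0 mf mg fg; apply/eqP; rewrite eq_le.
by rewrite !le_iter_shiftop// => y y0; rewrite fg.
Qed.

Lemma mge0_norm f : mge0 f -> mge0 (fun y => `|y|%:E * f y).
Proof.
by move=> mf; apply: mge0M => //; apply: mge0_EFin => //; exact: measurable_normr.
Qed.

(** For [0 <= x] and [0 < z] the absolute value is additive, [|x + z| = |x| + |z|], so the factor
    splits into the start and the claim. *)
Lemma shiftop_normM f x : (0 <= x)%R -> mge0 f ->
  shiftop a (fun y => `|y|%:E * f y) x = `|x|%:E * shiftop a f x + shiftop Ua f x.
Proof.
move=> x0 mf.
have mf' := mge0M (mge0_EFin ma a0) (mge0_shift x mf).
have mg' := mge0M (mge0_EFin mUa Ua0) (mge0_shift x mf).
rewrite /shiftop -ge0_integralZl//; first last.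
- by move=> z _; exact: mf'.2.
- exact: mf'.1.
rewrite -ge0_integralD//; first last.
- exact: mg'.1.
- by move=> z _; exact: mg'.2.
- by apply: emeasurable_funM => //; exact: mf'.1.
- by move=> z _; apply: mule_ge0 => //; exact: mf'.2.
apply: eq_integral => z _; rewrite /Ua.
have [->|/apos z0] := eqVneq (a z) 0%R; first by rewrite mulr0 !mul0e mule0 add0e.
rewrite !ger0_norm ?addr_ge0 ?(ltW z0)//.
rewrite !muleA -!EFinM -ge0_muleDl ?lee_fin ?mulr_ge0 ?(ltW z0)//.
by rewrite -EFinD -mulrDl mulrC.
Qed.

(** Each of the [n.+1] claims contributes equally to the factor [x + S_(n+1)]: [shiftopC] brings the
    size-biased claim to the front, whatever its position. *)
Lemma iter_shiftop_normM f n x : (0 <= x)%R -> mge0 f ->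
  iter n.+1 (shiftop a) (fun y => `|y|%:E * f y) x =
  `|x|%:E * iter n.+1 (shiftop a) f x +
  n.+1%:R%:E * shiftop Ua (iter n (shiftop a) f) x.
Proof.
move=> x0 mf; elim: n x x0 => [|n IH] x x0; first by rewrite /= mul1e shiftop_normM.
have mfn k : mge0 (iter k (shiftop a) f) by exact: mge0_iter_shiftop.
have mUn k : mge0 (shiftop Ua (iter k (shiftop a) f)) by exact: mge0_shiftop.
rewrite iterS.
have mR : mge0 (fun y => n.+1%:R%:E * shiftop Ua (iter n (shiftop a) f) y).
  by apply: mge0M => //; apply: mge0_cst; rewrite lee_fin.
have mL : mge0 (fun y => `|y|%:E * iter n.+1 (shiftop a) f y) by exact: mge0_norm.
rewrite (@eq_shiftop _ _ ((fun y => `|y|%:E * iter n.+1 (shiftop a) f y) \+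
  (fun y => n.+1%:R%:E * shiftop Ua (iter n (shiftop a) f) y)))//; first last.
- by move=> z /apos z0; rewrite IH// addr_ge0// ltW.
- exact: mge0D.
- by apply: mge0_iter_shiftop => //; exact: mge0_norm.
rewrite shiftopD// (@shiftop_normM (iter n.+1 (shiftop a) f))//.
rewrite -addeA; congr (_ + _).
have k0 : 0 <= n.+1%:R%:E :> \bar R by rewrite lee_fin.
have -> := shiftopZ ma a0 x k0 (mUn n).
rewrite (shiftopC ma a0 mUa Ua0 (mfn n)) -[shiftop a (iter n _ _)]/(iter n.+1 (shiftop a) f).
rewrite -{1}[shiftop Ua _ x]mul1e -ge0_muleDl ?lee_fin// -EFinD -natr1 addrC.
Qed.

(* Exchangeability of the claims: [E[S_k f(S_n)] = k / n E[S_n f(S_n)]]. *)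
Lemma iter_shiftop_exchange f k m : mge0 f -> (0 < k)%N ->
  iter k (shiftop a) (fun y => `|y|%:E * iter m (shiftop a) f y) 0%R =
  (k%:R / (k + m)%:R)%:E * iter (k + m)%N (shiftop a) (fun y => `|y|%:E * f y) 0%R.
Proof.
case: k => // k mf _; have mfm := mge0_iter_shiftop ma a0 m mf.
(* From the start 0 only the size-biased terms survive, and the two sides contain the same one with
   coefficients [k] and [k + m]. *)
rewrite iter_shiftop_normM// addSn iter_shiftop_normM// normr0 !mul0e !add0e.
by rewrite iterD muleA -EFinM divfK.
Qed.

End positive_weight.
End shiftop.

(** * Convolution powers as densities of sums of claims *)

Section bridge.
Context {R : realType}.
Notation leb := (@lebesgue_measure R).
Notation MR := (measurableTypeR R).
Local Open Scope ereal_scope.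
Variable p : R -> R.
Hypotheses (mp : measurable_fun `](0 : R)%R, +oo[ p) (p_ge0 : forall x, (0 < x)%R -> (0 <= p x)%R).

(** Cuts off the argument, not the value: this is [p] extended by 0, hence a function on the whole
    line. *)
Definition pos_part (z : R) : R := if (0 < z)%R then p z else 0%R.

Lemma pos_part_ge0 z : (0 <= pos_part z)%R.
Proof. by rewrite /pos_part; case: ifPn => // /p_ge0. Qed.

Lemma measurable_pos_part : measurable_fun setT pos_part.
Proof.
have -> : pos_part = p \_ `]0%R, +oo[.
  by apply/funext => z; rewrite patchE mem_setE in_itv /= andbT.
by apply/(measurable_restrictT _ _).1.
Qed.

Lemma pos_part_le0 z : (z <= 0)%R -> pos_part z = 0%R.
Proof. by move=> z0; rewrite /pos_part ltNge z0. Qed.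

(** Index [n] stands for the [n.+1]-fold convolution, here with integrals over the whole line. *)
Fixpoint conv_pos (n : nat) (z : R) : \bar R :=
  if n is n'.+1 then \int[leb]_y (conv_pos n' (z - y)%R * (pos_part y)%:E)
  else (pos_part z)%:E.

Lemma conv_pos_le0 n z : (z <= 0)%R -> conv_pos n z = 0.
Proof.
elim: n z => [|n IH] z z0 /=; first by rewrite pos_part_le0.
apply: integral0_eq => y _; have [y0|y0] := leP y 0%R.
  by rewrite pos_part_le0// mule0.
by rewrite IH ?mul0e// subr_le0 (le_trans z0)// ltW.
Qed.

(** Both factors vanish at nonpositive arguments, so the integral over the line reduces to
    [0 < y < z]. *)
Lemma conv_powE n z : (0 < z)%R -> conv_pow p n.+1 z = conv_pos n z.
Proof.
elim: n z => [|n IH] z z0; first by rewrite /conv_pow /= /pos_part z0.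
transitivity (\int[leb]_(y in `]0%R, z[) (conv_pow p n.+1 (z - y)%R * (p y)%:E)) => //.
rewrite -[RHS]/(\int[leb]_y (conv_pos n (z - y)%R * (pos_part y)%:E)).
rewrite integral_mkcond; apply: eq_integral => y _.
rewrite patchE mem_setE in_itv /=.
have [y0|y0] /= := ltP 0%R y; last by rewrite pos_part_le0// mule0.
have [yz|yz] := ltP y z; last by rewrite conv_pos_le0 ?mul0e// subr_le0.
by rewrite -IH ?subr_gt0// /pos_part y0.
Qed.

Lemma mge0_conv_pos n : mge0 (conv_pos n).
Proof.
have mp0 := mge0_EFin measurable_pos_part pos_part_ge0.
elim: n => [|n [mn n0]]; first exact: mp0.
split; last by move=> z; apply: integral_ge0 => y _; rewrite mule_ge0// lee_fin pos_part_ge0.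
apply: (measurable_fun_fubini_tonelli_F
  (fun z : MR * MR => conv_pos n (z.1 - z.2)%R * (pos_part z.2)%:E)).
  apply: emeasurable_funM; last exact: (measurable_comp_snd mp0.1).
  exact: (measurableT_comp mn measurable_sub2).
by move=> z; rewrite mule_ge0// lee_fin pos_part_ge0.
Qed.

(** Expresses that [conv_pos n] is the density of the sum of [n.+1] claims; [integral_conv] peels
    off one claim at a time. *)
Lemma integral_conv_pos n F : mge0 F ->
  \int[leb]_z (F z * conv_pos n z) = iter n.+1 (shiftop pos_part) F 0%R.
Proof.
have mp0 := mge0_EFin measurable_pos_part pos_part_ge0.
elim: n F => [|n IH] F mF.
  by apply: eq_integral => z _; rewrite add0r muleC.
have mn := mge0_conv_pos n.
have := integral_conv mF.1 mn.1 mp0.1 mF.2 mn.2 mp0.2.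
move=> /= ->.
apply: eq_integral => y _; congr (_ * _).
have mFy : mge0 (fun t => F (y + t)%R) by exact: mge0_shift.
under eq_integral do rewrite addrC.
by have -> := IH _ mFy; rewrite iter_shiftop_shift addr0 add0r.
Qed.
End bridge.

(** * The terms of the series *)

Section term.
Context {R : realType}.
Notation leb := (@lebesgue_measure R).
Notation MR := (measurableTypeR R).
Local Open Scope ereal_scope.
Variable p : R -> R.
Hypotheses (mp : measurable_fun `](0 : R)%R, +oo[ p) (p_ge0 : forall x, (0 < x)%R -> (0 <= p x)%R).
Notation p0 := (pos_part p).
Variables (q c D w : R).

(** The [b_n] of the overview; the absolute value makes it nonnegative on the whole line, so that
    [shiftop] can act on it. *)
Definition kendall_term (n : nat) (y : R) : \bar R :=
  `|y|%:E * ((w ^+ n / n`!%:R)%:E * iter n (shiftop p0) (kernel_moment q c D n) y).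

Lemma mge0_kernel_moment n : mge0 (kernel_moment q c D n).
Proof. by split; [exact: measurable_kernel_moment|exact: kernel_moment_ge0]. Qed.

Lemma integral_moment_kernel_conv n (k x : R) : (0 <= k)%R ->
  \int[leb]_s \int[leb]_z ((k * moment_kernel q c D n.+1 (x + z) s)%:E * conv_pos p n z) =
  k%:E * iter n.+1 (shiftop p0) (kernel_moment q c D n.+1) x.
Proof.
move=> k0.
have mn := mge0_conv_pos mp p_ge0 n.
rewrite (fubini_tonelli (fun z : MR * MR =>
  (k * moment_kernel q c D n.+1 (x + z.2) z.1)%:E * conv_pos p n z.2))/=; first last.
- by move=> z; apply: mule_ge0; [rewrite lee_fin mulr_ge0 ?moment_kernel_ge0|exact: mn.2].
- apply: emeasurable_funM; last exact: (measurable_comp_snd mn.1).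
  apply/measurable_EFinP; apply: measurable_funM => //; apply: measurable_moment_kernel.
    by apply: measurable_funD => //; exact: measurable_snd.
  exact: measurable_fst.
have mKx := mge0_shift x (mge0_kernel_moment n.+1).
have H := integral_conv_pos mp p_ge0 n mKx.
rewrite iter_shiftop_shift addr0 /= in H.
rewrite -H -ge0_integralZl//; first last.
- by move=> z _; exact: (mge0M mKx mn).2.
- exact: (mge0M mKx mn).1.
apply: eq_integral => z _; rewrite muleA /kernel_moment -ge0_integralZl//; first last.
- by move=> s _; rewrite lee_fin moment_kernel_ge0.
- by apply/measurable_EFinP; exact: measurable_moment_kernel.
rewrite -ge0_integralZr//; first last.
- exact: mn.2.
- by move=> s _; rewrite mule_ge0 ?lee_fin ?moment_kernel_ge0.
- by apply: emeasurable_funM => //; apply/measurable_EFinP; exact: measurable_moment_kernel.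
Qed.

End term.

(** The Poisson weight, the discount factor and [x / s] combine to [expR (- (q * s)) * s ^+ n / s]
    with the constant [x * w ^+ n / n!]; Tonelli then exchanges time and claim sizes. *)
Lemma kendall_termE (R : realType) (p : R -> R) (c lambda sigma r delta : R) n (x : R) :
  measurable_fun `](0 : R)%R, +oo[ p -> (forall x, 0 < x -> 0 <= p x) ->
  0 < lambda -> 0 < r -> 0 < x ->
  ((r ^+ n)%:E * \int[lebesgue_measure]_(s in `]0%R, +oo[)
       ((expR (- (delta * s)) * (x / s))%:E * g c lambda sigma p s n x) =
  kendall_term p (lambda + delta)%R c (sigma ^+ 2 / 2)%R (lambda * r) n x)%E.
Proof.
move=> mp p_ge0 l0 r0 x0; rewrite /kendall_term gtr0_norm//.
set q := lambda + delta; set D := sigma ^+ 2 / 2; set w := lambda * r.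
(* The predecessor accounts for the shifted index of [conv_pos]; the case [n = 0], where [g] has no
   convolution, is treated apart. *)
have mn := mge0_conv_pos mp p_ge0 n.-1.
have mk y : measurable_fun setT (fun s : measurableTypeR R => (moment_kernel q c D n y s)%:E).
  by apply/measurable_EFinP; exact: measurable_moment_kernel.
case: n mn mk => [|n] mn mk.
  rewrite expr0 mul1e expr0 fact0 divr1 mul1e /= /kernel_moment.
  rewrite -ge0_integralZl ?lee_fin ?(ltW x0)//; last first.
    by move=> s _; rewrite lee_fin moment_kernel_ge0.
  rewrite [LHS]integral_mkcond. apply: eq_integral => s _.
  rewrite patchE mem_setE in_itv /= andbT /moment_kernel; case: ifPn => s0; last by rewrite mule0.
  rewrite -!EFinM; congr EFin.
  rewrite /gauss_kernel -/D /q expr0 mulr1 (mulrDl lambda) !opprD !expRD.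
  by ring.
set k := x * (lambda ^+ n.+1 / n.+1`!%:R).
have k0 : 0 <= k by rewrite mulr_ge0 ?divr_ge0 ?exprn_ge0// ltW.
transitivity ((r ^+ n.+1)%:E *
  (k%:E * iter n.+1 (shiftop (pos_part p)) (kernel_moment q c D n.+1) x))%E; last first.
  rewrite !muleA; congr (_ * _)%E; rewrite -!EFinM; congr EFin.
  by rewrite /k /w exprMn; ring.
congr (_ * _)%E; rewrite -integral_moment_kernel_conv//.
rewrite integral_mkcond; apply: eq_integral => s _.
rewrite patchE mem_setE in_itv /= andbT; case: ifPn => s0; last first.
  by rewrite integral0_eq// => z _; rewrite /moment_kernel (negbTE s0) mulr0 mul0e.
rewrite /g -/D.
have -> : (\int[lebesgue_measure]_(z in `]0%R, +oo[)
    (((2 * Num.sqrt (pi * D * s))^-1 *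
      expR (- ((z + x - c * s) ^+ 2 / (4 * D * s))))%:E * conv_pow p n.+1 z) =
    \int[lebesgue_measure]_z ((gauss_kernel c D s (z + x))%:E * conv_pos p n z))%E.
  rewrite integral_mkcond; apply: eq_integral => z _.
  rewrite patchE mem_setE in_itv /= andbT; case: ifPn => z0.
    by rewrite conv_powE.
  by rewrite conv_pos_le0 ?mule0// leNgt.
have mg : mge0 (fun z => (gauss_kernel c D s (z + x))%:E).
  apply: mge0_EFin => [|z]; last exact: gauss_kernel_ge0.
  by apply: measurable_gauss_kernel => //; exact: measurable_funD.
rewrite muleA -EFinM -ge0_integralZl//; first last.
- rewrite lee_fin mulr_ge0// mulr_ge0 ?expR_ge0//.
    by rewrite divr_ge0 ?(ltW x0) ?(ltW s0).
  by rewrite divr_ge0// exprn_ge0// mulr_ge0 ?(ltW l0) ?(ltW s0).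
- by move=> z _; exact: (mge0M mg mn).2.
- exact: (mge0M mg mn).1.
apply: eq_integral => z _; rewrite muleA -EFinM; congr (_%:E * _)%E.
rewrite /moment_kernel s0 [x + z]addrC [RHS]mulrA; congr (_ * _).
rewrite /k /q (mulrDl lambda) opprD expRD exprMn; ring.
Qed.

(** * Laplace transform of the first passage density *)

Section laplace_K.
Context {R : realType}.
Notation leb := (@lebesgue_measure R).
Notation MR := (measurableTypeR R).
Local Open Scope ereal_scope.

Lemma nneseries_expR (x : R) : (0 <= x)%R ->
  \sum_(0 <= k <oo) (x ^+ k / k`!%:R)%:E = (expR x)%:E.
Proof.
move=> x0; rewrite /expR -EFin_lim; last exact: is_cvg_series_exp_coeff.
congr (limn _); apply/funext => n; rewrite /= /series /= -sumEFin.
by apply: eq_bigr.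
Qed.

(** The exponential series sums to [expR (v * s)] under the integral. As
    [q - v = D * beta ^+ 2 + c * beta], an exponential tilt extracts [expR (- (beta * x))] and
    raises the drift to [c + 2 * D * beta]; the tilted first passage density has mass 1. *)
Lemma nneseries_kernel_moment (q c D v beta x : R) : (0 < c)%R -> (0 < D)%R -> (0 <= v)%R ->
  (0 <= beta)%R -> (0 < x)%R -> (D * beta ^+ 2 + c * beta + v = q)%R ->
  \sum_(0 <= k <oo) ((v ^+ k / k`!%:R)%:E * (x%:E * kernel_moment q c D k x)) =
  (expR (- (beta * x)))%:E.
Proof.
move=> c0 D0 v0 b0 x0 qE.
have mk n : measurable_fun setT (fun s : MR => (moment_kernel q c D n x s)%:E).
  by apply/measurable_EFinP; exact: measurable_moment_kernel.
have v0k k : (0 <= v ^+ k / k`!%:R)%R by rewrite divr_ge0 ?exprn_ge0.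
transitivity (\int[leb]_s \sum_(0 <= k <oo) (v ^+ k / k`!%:R * (x * moment_kernel q c D k x s))%:E).
  rewrite integral_nneseries//; first last.
  - by move=> k s _; rewrite lee_fin !mulr_ge0 ?moment_kernel_ge0 ?invr_ge0 ?exprn_ge0 ?(ltW x0).
  - move=> k; apply/measurable_EFinP; apply: measurable_funM => //.
    by apply: measurable_funM => //; exact: measurable_moment_kernel.
  apply: eq_eseriesr => k _.
  rewrite muleA -EFinM /kernel_moment -ge0_integralZl//; first last.
  - by rewrite lee_fin mulr_ge0// ltW.
  - by move=> s _; rewrite lee_fin moment_kernel_ge0.
  by apply: eq_integral => s _; rewrite -EFinM mulrA.
transitivity (\int[leb]_(s in `]0%R, +oo[)
   ((expR (- (beta * x)))%:E * (x / s * gauss_kernel (c + 2 * D * beta) D s x)%:E)).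
  rewrite [RHS]integral_mkcond; apply: eq_integral => s _.
  rewrite patchE mem_setE in_itv /= andbT /moment_kernel; case: ifPn => s0; last first.
    by rewrite eseries0// => k _ _; rewrite mulr0 mulr0.
  have e : (expR (- (q * s)) * gauss_kernel c D s x * expR (v * s) =
            expR (- (beta * x)) * gauss_kernel (c + 2 * D * beta) D s x)%R.
    have ringE (A e1 e2 e3 : R) : (e1 * (A * e2) * e3 = A * (e1 * e2 * e3))%R by ring.
    rewrite /gauss_kernel ringE [RHS]mulrCA; congr (_ * _)%R.
    by rewrite -!expRD; congr expR; rewrite -qE; field; rewrite !gt_eqF.
  transitivity (\sum_(0 <= k <oo) ((x / s * (expR (- (q * s)) * gauss_kernel c D s x))%:E *
     ((v * s) ^+ k / k`!%:R)%:E)).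
    apply: eq_eseriesr => k _; rewrite -EFinM; congr EFin.
    by rewrite exprMn; ring.
  rewrite nneseriesZl; last by move=> k _; rewrite lee_fin divr_ge0 ?exprn_ge0 ?mulr_ge0 ?(ltW s0).
  rewrite nneseries_expR ?mulr_ge0 ?(ltW s0)//.
  by rewrite -!EFinM -[X in X%:E]mulrA e; congr EFin; ring.
rewrite ge0_integralZl//.
- by rewrite integral_gauss_kernel ?mule1// ltr_wpDr// !mulr_ge0// ltW.
- apply/measurable_EFinP; apply: measurable_funTS; apply: measurable_funM.
    by apply: measurable_funM => //; exact: measurable_inv.
  exact: measurable_gauss_kernel.
- move=> s /=; rewrite in_itv /= andbT => s0.
  by rewrite lee_fin mulr_ge0 ?gauss_kernel_ge0// divr_ge0 ?(ltW x0) ?(ltW s0).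
Qed.
End laplace_K.

(** * Kendall's identity and the fixed point equation *)

Section ereal_series.
Context {R : realType}.
Local Open Scope ereal_scope.

Lemma nneseriesS (f : nat -> \bar R) : (forall k, 0 <= f k) ->
  \sum_(0 <= k <oo) f k = f 0%N + \sum_(0 <= k <oo) f k.+1.
Proof.
move=> f0; rewrite nneseries_recl// -(nneseries_addn 1)//; congr (_ + _).
by apply: eq_eseriesr => k _; rewrite addn1.
Qed.

Lemma sum_le_nneseries (f : nat -> \bar R) N : (forall k, 0 <= f k) ->
  \sum_(k < N) f k <= \sum_(0 <= k <oo) f k.
Proof. by move=> f0; rewrite -(big_mkord xpredT f); exact: nneseries_lim_ge. Qed.

Lemma nneseries_le (f : nat -> \bar R) B : (forall k, 0 <= f k) ->
  (forall N, \sum_(k < N) f k <= B) -> \sum_(0 <= k <oo) f k <= B.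
Proof.
move=> f0 fB; apply: lime_le; first exact: is_cvg_nneseries.
by apply: nearW => N; rewrite big_mkord.
Qed.

Lemma sum_triangle (A : nat -> nat -> \bar R) M :
  \sum_(n < M) \sum_(k < n.+1) A k (n - k)%N = \sum_(k < M) \sum_(m < M - k) A k m.
Proof.
elim: M => [|M IH]; first by rewrite !big_ord0.
rewrite big_ord_recr /= IH [RHS]big_ord_recr/= subSnn big_ord1.
rewrite [X in _ + X]big_ord_recr/= subnn addeA -big_split/=; congr (_ + _).
apply: eq_bigr => k _; rewrite subSn; last exact: ltnW.
by rewrite big_ord_recr.
Qed.

Lemma le_sum_ord (f : nat -> \bar R) N M : (N <= M)%N -> (forall k, 0 <= f k) ->
  \sum_(k < N) f k <= \sum_(k < M) f k.
Proof.
move=> NM f0; rewrite -(subnKC NM) big_split_ord/= leeDl// sume_ge0//.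
Qed.

End ereal_series.

Section series.
Context {R : realType}.
Notation leb := (@lebesgue_measure R).
Notation MR := (measurableTypeR R).
Local Open Scope ereal_scope.
Variable p : R -> R.
Hypotheses (mp : measurable_fun `](0 : R)%R, +oo[ p) (p_ge0 : forall x, (0 < x)%R -> (0 <= p x)%R).
Notation p0 := (pos_part p).
Variables (q c D w : R).
Hypotheses (c0 : (0 < c)%R) (D0 : (0 < D)%R) (w0 : (0 <= w)%R).
Variable a : R.
Hypotheses (a0 : (0 <= a)%R) (aE : (D * a ^+ 2 + c * a + w = q)%R).

Let mp0 : measurable_fun setT p0 := measurable_pos_part mp.
Let p00 : forall z, (0 <= p0 z)%R := pos_part_ge0 p_ge0.
Notation T := (shiftop p0).
Notation Kn := (kernel_moment q c D).
Notation b := (kendall_term p q c D w).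

(* [climb k f x] is the part, due to exactly [k] claims arriving during the climb
   of the Brownian motion from [0] to [x], of the expectation of [f] at the
   distance left to be climbed. *)
Definition climb (k : nat) (f : R -> \bar R) (x : R) : \bar R :=
  (w ^+ k / k`!%:R)%:E * (x%:E * Kn k x) * iter k T f 0%R.

Let wk k : (0 <= w ^+ k / k`!%:R)%R. Proof. by rewrite divr_ge0 ?exprn_ge0. Qed.

Lemma mge0_kendall_term n : mge0 (b n).
Proof.
apply: mge0_norm; apply: mge0M; first by apply: mge0_cst; rewrite lee_fin.
apply: mge0_iter_shiftop => //; exact: mge0_kernel_moment.
Qed.

Lemma climb_coef_ge0 k x : (0 < x)%R -> 0 <= (w ^+ k / k`!%:R)%:E * (x%:E * Kn k x).
Proof. by move=> x0; rewrite !mule_ge0 ?kernel_moment_ge0 ?lee_fin// ltW. Qed.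

(** The coefficient is a single term of a nonnegative series with sum [expR (- (a * x))]. Finiteness
    allows it to be moved across infinite sums. *)
Lemma climb_coef_fin k x : (0 < x)%R ->
  (w ^+ k / k`!%:R)%:E * (x%:E * Kn k x) \is a fin_num.
Proof.
move=> x0; rewrite ge0_fin_numE ?climb_coef_ge0//.
apply: (@le_lt_trans _ _ (expR (- (a * x)))%:E); last exact: ltry.
rewrite -(nneseries_kernel_moment c0 D0 w0 a0 x0 aE).
apply: (le_trans _ (sum_le_nneseries k.+1 (fun k => climb_coef_ge0 k x0))).
by rewrite big_ord_recr /= leeDr// sume_ge0// => i _; exact: climb_coef_ge0.
Qed.

Lemma climb_ge0 k f x : (0 < x)%R -> mge0 f -> 0 <= climb k f x.
Proof.
move=> x0 mf; apply: mule_ge0; first exact: climb_coef_ge0.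
exact: (mge0_iter_shiftop mp0 p00 k mf).2.
Qed.

Lemma le_climb k f h x : (0 < x)%R -> mge0 f -> mge0 h ->
  (forall y, (0 < y)%R -> f y <= h y) -> climb k.+1 f x <= climb k.+1 h x.
Proof.
move=> x0 mf mh fh; apply: lee_wpmul2l; first exact: climb_coef_ge0.
by apply: le_iter_shiftop => //; exact: pos_part_le0.
Qed.

Lemma climb_sum k (f : nat -> R -> \bar R) N x : (0 < x)%R -> (forall i, mge0 (f i)) ->
  climb k (fun y => \sum_(i < N) f i y) x = \sum_(i < N) climb k (f i) x.
Proof.
move=> x0 mf; rewrite /climb (iter_shiftop_sum mp0 p00 _ k (fun i : 'I_N => mf i)).
rewrite ge0_sume_distrr// => i _; exact: (mge0_iter_shiftop mp0 p00 k (mf i)).2.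
Qed.

Lemma climb_nneseries k (f : nat -> R -> \bar R) x : (0 < x)%R -> (forall i, mge0 (f i)) ->
  climb k (fun y => \sum_(0 <= i <oo) f i y) x = \sum_(0 <= i <oo) climb k (f i) x.
Proof.
move=> x0 mf; rewrite /climb (iter_shiftop_nneseries mp0 p00 k mf).
rewrite -(fineK (climb_coef_fin k x0)) nneseriesZl//.
by move=> i _; exact: (mge0_iter_shiftop mp0 p00 k (mf i)).2.
Qed.

Lemma climbD k f h x : (0 < x)%R -> mge0 f -> mge0 h ->
  climb k (f \+ h) x = climb k f x + climb k h x.
Proof.
move=> x0 mf mh; rewrite /climb (iter_shiftopD mp0 p00 k mf mh).
rewrite ge0_muleDr//.
- exact: (mge0_iter_shiftop mp0 p00 k mf).2.
- exact: (mge0_iter_shiftop mp0 p00 k mh).2.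
Qed.

Lemma climbZ k (l : \bar R) f x : (0 <= l) -> mge0 f ->
  climb k (fun y => l * f y) x = l * climb k f x.
Proof. by move=> l0 mf; rewrite /climb (iter_shiftopZ mp0 p00 k l0 mf) muleCA. Qed.

(** By exchangeability each summand becomes an expectation over all [n.+1] claims with a factor
    [k.+1 / n.+1], which turns the factorials into ['C(n, k) / n.+1!]; [kernel_moment_conv] then
    sums over [k]. *)
Lemma kendall_term_rec n x : (0 < x)%R ->
  b n.+1 x = \sum_(k < n.+1) climb k.+1 (b (n - k)%N) x.
Proof.
move=> x0.
have mK m : mge0 (Kn m) by exact: mge0_kernel_moment.
pose h m (y : R) := `|y|%:E * Kn m y.
have mh m : mge0 (h m) by exact: mge0_norm.
have mT m : mge0 (iter m T (Kn m)) by exact: mge0_iter_shiftop.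
have climbE (k : 'I_n.+1) : climb k.+1 (b (n - k)%N) x =
   (x * (w ^+ n.+1 / n.+1`!%:R))%:E *
   iter n.+1 T (fun y => ('C(n, k)%:R%:E * Kn k.+1 x) * h (n - k)%N y) 0%R.
  have kn : (k <= n)%N by rewrite -ltnS.
  rewrite /climb.
  have -> : b (n - k)%N = (fun y => (w ^+ (n - k) / (n - k)`!%:R)%:E *
      (`|y|%:E * iter (n - k) T (Kn (n - k)%N) y)).
    by apply/funext => y; rewrite /kendall_term muleCA.
  rewrite (iter_shiftopZ mp0 p00 k.+1 _ (mge0_norm (mT (n - k)%N))) ?lee_fin//.
  rewrite (iter_shiftop_exchange mp0 p00 (pos_part_le0 p) (n - k)%N (mK (n - k)%N) (ltn0Sn k)).
  rewrite addSn subnKC//.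
  rewrite (iter_shiftopZ mp0 p00 n.+1 _ (mh (n - k)%N)); last first.
    by rewrite mule_ge0 ?kernel_moment_ge0 ?lee_fin.
  rewrite -/(h (n - k)%N).
  set t := iter n.+1 T _ 0%R.
  have -> : (w ^+ k.+1 / k.+1`!%:R)%:E * (x%:E * Kn k.+1 x) *
      ((w ^+ (n - k) / (n - k)`!%:R)%:E * ((k.+1%:R / n.+1%:R)%:E * t)) =
      (w ^+ k.+1 / k.+1`!%:R * x * (w ^+ (n - k) / (n - k)`!%:R * (k.+1%:R / n.+1%:R)))%:E *
      (Kn k.+1 x * t).
    by rewrite (muleA _ x%:E) -EFinM (muleA (w ^+ (n - k) / _)%:E) -EFinM muleACA -EFinM.
  rewrite -(muleA 'C(n, k)%:R%:E) (muleA _ 'C(n, k)%:R%:E) -EFinM; congr (_%:E * _).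
  have -> : (w ^+ n.+1 = w ^+ k.+1 * w ^+ (n - k))%R by rewrite -exprD addSn subnKC.
  have Ck : ('C(n, k)%:R = n`!%:R / (k`!%:R * (n - k)`!%:R) :> R)%R.
    by rewrite -(bin_fact kn) !natrM mulfK// -natrM pnatr_eq0 -lt0n muln_gt0 !fact_gt0.
  rewrite Ck !factS !natrM.
  have f0 m : m`!%:R != 0%R :> R by rewrite pnatr_eq0 -lt0n fact_gt0.
  by field; rewrite !f0 /= !(addrC 1%R) !natr1 !pnatr_eq0.
rewrite (eq_bigr _ (fun k _ => climbE k)).
have mr (k : 'I_n.+1) : mge0 (fun y => 'C(n, k)%:R%:E * Kn k.+1 x * h (n - k)%N y).
  by apply: mge0M => //; apply: mge0_cst; rewrite mule_ge0 ?kernel_moment_ge0 ?lee_fin.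
rewrite -ge0_sume_distrr; last first.
  by move=> k _; exact: (mge0_iter_shiftop mp0 p00 n.+1 (mr k)).2.
have := iter_shiftop_sum mp0 p00 (index_enum 'I_n.+1) n.+1 mr.
move=> /(congr1 (fun f => f 0%R)) <-.
(* The convolution identity requires [0 < y], which holds at a sum of [n.+1] positive claims. *)
rewrite (@eq_iter_shiftop _ _ mp0 p00 (pos_part_le0 p) _ (fun y => Kn n.+1 (x + y)%R))//; first last.
- move=> y y0; rewrite -(kernel_moment_conv q c D0 n x0 y0); apply: eq_bigr => k _.
  by rewrite /h gtr0_norm// -muleA.
- by apply: mge0_shift.
- exact: mge0_sum.
rewrite iter_shiftop_shift addr0 /kendall_term gtr0_norm// muleA.
by rewrite -EFinM.
Qed.
Lemma climb_cst1 k x : \int[leb]_z (p0 z)%:E = 1 ->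
  climb k (fun=> 1) x = (w ^+ k / k`!%:R)%:E * (x%:E * Kn k x).
Proof.
move=> p1; rewrite /climb.
have -> : iter k T (fun=> 1) = (fun=> 1).
  elim: k => //= k ->; apply/funext => y; rewrite /shiftop -[RHS]p1.
  by apply: eq_integral => z _; rewrite mule1.
by rewrite mule1.
Qed.

(** Exponentials are eigenfunctions of [shiftop], the eigenvalue [l] being the Laplace transform of
    the claim density. *)
Lemma climb_expR k rho l x :
  \int[leb]_z ((p0 z)%:E * (expR (- (rho * z)))%:E) = l%:E ->
  climb k (fun y => (expR (- (rho * y)))%:E) x =
  ((w * l) ^+ k / k`!%:R)%:E * (x%:E * Kn k x).
Proof.
move=> pl; rewrite /climb.
have l0 : (0 <= l)%R.
  by rewrite -lee_fin -pl; apply: integral_ge0 => z _; rewrite mule_ge0 ?lee_fin ?expR_ge0.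
have me : mge0 (fun y => (expR (- (rho * y)))%:E).
  apply: mge0_EFin => [|y]; last exact: expR_ge0.
  by apply: measurableT_comp => //; apply: measurableT_comp => //; exact: measurable_funM.
have -> : iter k T (fun y => (expR (- (rho * y)))%:E) =
    (fun y => (l ^+ k)%:E * (expR (- (rho * y)))%:E).
  elim: k => [|k IH]; first by apply/funext => y; rewrite mul1e.
  rewrite iterS IH; apply/funext => y.
  have -> := shiftopZ mp0 p00 y (_ : 0 <= (l ^+ k)%:E) me; last by rewrite lee_fin exprn_ge0.
  rewrite exprSr EFinM -muleA; congr (_ * _); rewrite -pl /shiftop -ge0_integralZr ?lee_fin ?expR_ge0//.
  - by apply: eq_integral => z _; rewrite -!EFinM -mulrA -expRD; congr (_ * expR _)%:E; ring.
  - exact: (mge0M (mge0_EFin mp0 p00) me).1.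
  - by move=> z _; exact: (mge0M (mge0_EFin mp0 p00) me).2.
rewrite mulr0 oppr0 expR0 mule1 muleC muleA -EFinM exprMn.
by congr (_%:E * _); ring.
Qed.

Lemma kendall_term0 x : (0 < x)%R -> b 0%N x = (w ^+ 0 / 0`!%:R)%:E * (x%:E * Kn 0%N x).
Proof. by move=> x0; rewrite /kendall_term gtr0_norm// muleCA. Qed.

Section fixpoint.
Variables (rho l : R).
Hypothesis rho0 : (0 < rho)%R.
Hypothesis pl : \int[leb]_z ((p0 z)%:E * (expR (- (rho * z)))%:E) = l%:E.
Hypothesis rhoE : (D * rho ^+ 2 + c * rho + w * l = q)%R.
Let E (y : R) : \bar R := (expR (- (rho * y)))%:E.

Let l0 : (0 <= l)%R.
Proof.
by rewrite -lee_fin -pl; apply: integral_ge0 => z _; rewrite mule_ge0 ?lee_fin ?expR_ge0.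
Qed.

Let mE : mge0 E.
Proof.
apply: mge0_EFin => [|y]; last exact: expR_ge0.
by apply: measurableT_comp => //; apply: measurableT_comp => //; exact: measurable_funM.
Qed.

(** [rhoE] is the condition of [nneseries_kernel_moment] for [v = w * l], and the factors [l ^+ k]
    are supplied by [climb_expR]. *)
Let E_fixpoint x : (0 < x)%R ->
  E x = b 0%N x + \sum_(0 <= k <oo) climb k.+1 E x.
Proof.
move=> x0; rewrite /E -(nneseries_kernel_moment c0 D0 (mulr_ge0 w0 l0) (ltW rho0) x0 rhoE).
rewrite [LHS]nneseriesS; last first.
  by move=> k; have := climb_ge0 k x0 mE; rewrite (climb_expR _ _ pl).
rewrite kendall_term0// !expr0; congr (_ + _).
by apply: eq_eseriesr => k _; rewrite (climb_expR _ _ pl).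
Qed.

Let bS N x : (0 < x)%R ->
  \sum_(n < N) b n.+1 x = \sum_(k < N) \sum_(m < N - k) climb k.+1 (b m) x.
Proof.
move=> x0; rewrite -(sum_triangle (fun k m => climb k.+1 (b m) x)).
by apply: eq_bigr => n _; exact: kendall_term_rec.
Qed.

Let psib0 x k m : (0 < x)%R -> 0 <= climb k (b m) x.
Proof. by move=> x0; apply: climb_ge0 => //; exact: mge0_kendall_term. Qed.

Lemma sum_kendall_term_le N x : (0 < x)%R -> \sum_(n < N) b n x <= E x.
Proof.
elim: N x => [|N IH] x x0; first by rewrite big_ord0; exact: mE.2.
rewrite big_ord_recl E_fixpoint// leeD2l// bS//.
apply: (le_trans _ (sum_le_nneseries N (fun k => climb_ge0 k.+1 x0 mE))).
apply: lee_sum => k _.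
(* Extending every row of the triangle to length [N] produces the partial sum covered by the
   induction hypothesis. *)
apply: (@le_trans _ _ (\sum_(m < N) climb k.+1 (b m) x)).
  by apply: (@le_sum_ord _ (fun m => climb k.+1 (b m) x)) => [|m]; [exact: leq_subr|exact: psib0].
rewrite -(climb_sum k.+1 N x0 mge0_kendall_term).
have mb := mge0_sum (index_enum 'I_N) (fun i : 'I_N => mge0_kendall_term i).
by apply: (le_climb k x0 mb mE) => y y0; exact: IH.
Qed.

Let G y := \sum_(0 <= n <oo) b n y.

Let mG : mge0 G.
Proof. exact: mge0_nneseries mge0_kendall_term. Qed.

(** A finite rectangle of indices [k < N], [m < M] lies in the triangle of side [N + M], where
    Kendall's identity yields a partial sum of [G]. *)
Let psi_G_le x : (0 < x)%R ->
  b 0%N x + \sum_(0 <= k <oo) climb k.+1 G x <= G x.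
Proof.
move=> x0; rewrite [leRHS]nneseriesS; last by move=> k; exact: (mge0_kendall_term k).2.
rewrite leeD2l//; apply: nneseries_le => [k|N]; first exact: climb_ge0.
rewrite (eq_bigr _ (fun (k : 'I_N) _ => climb_nneseries k.+1 x0 mge0_kendall_term)).
rewrite -nneseries_sum; last by move=> k m _; exact: psib0.
apply: nneseries_le => [m|M]; first by apply: sume_ge0 => k _; exact: psib0.
apply: (le_trans _ (sum_le_nneseries (N + M) (fun k => (mge0_kendall_term k.+1).2 x))).
rewrite bS// exchange_big/= big_split_ord/=.
apply: (@le_trans _ _ (\sum_(k < N) \sum_(m < N + M - k) climb k.+1 (b m) x)).
  apply: lee_sum => k _; apply: (@le_sum_ord _ (fun m => climb k.+1 (b m) x)) => [|m]; last exact: psib0.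
  by rewrite -addnBAC ?leq_addl// ltnW.
by rewrite leeDl// sume_ge0// => k _; apply: sume_ge0 => m _; exact: psib0.
Qed.

Variable kappa : R.
Hypothesis kappa0 : (0 <= kappa)%R.
Hypothesis psi1_le : forall x, (0 < x)%R -> \sum_(0 <= k <oo) climb k.+1 (fun=> 1) x <= kappa%:E.

(** Starting from [E <= 1], each insertion of the bound into the fixed point equation multiplies the
    error by at most [kappa]. *)
Lemma expR_le_nneseries_kendall_term j x : (0 < x)%R -> E x <= G x + (kappa ^+ j)%:E.
Proof.
elim: j x => [|j IH] x x0.
  rewrite expr0 -[leLHS]add0e leeD ?mG.2//.
  by rewrite lee_fin -expR0 ler_expR oppr_le0 mulr_ge0// ltW.
have kj0 : 0 <= (kappa ^+ j)%:E by rewrite lee_fin exprn_ge0.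
have m1 : mge0 (fun=> 1 : \bar R) by exact: mge0_cst.
have mk : mge0 (fun=> (kappa ^+ j)%:E * 1 : \bar R) by apply: mge0_cst; rewrite mule1.
rewrite E_fixpoint//.
apply: (@le_trans _ _ (b 0%N x + \sum_(0 <= k <oo)
  (climb k.+1 G x + (kappa ^+ j)%:E * climb k.+1 (fun=> 1) x))).
  rewrite leeD2l//; apply: lee_nneseries => k _; first by move=> _; exact: climb_ge0.
  rewrite -climbZ// -climbD//; apply: (le_climb k x0 mE (mge0D mG mk)) => y y0.
  by rewrite /= mule1; exact: IH.
rewrite nneseriesD; first last.
- by move=> k _ _; rewrite mule_ge0//; exact: climb_ge0.
- by move=> k _ _; exact: climb_ge0.
rewrite addeA leeD ?psi_G_le// nneseriesZl; last by move=> k _; exact: climb_ge0.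
by rewrite exprSr EFinM lee_wpmul2l// psi1_le.
Qed.

Lemma nneseries_kendall_term x : (kappa < 1)%R -> (0 < x)%R ->
  (expR (- (rho * x)))%:E = \sum_(0 <= n <oo) b n x.
Proof.
move=> k1 x0; rewrite -/(E x) -/(G x); apply/eqP; rewrite eq_le; apply/andP; split; last first.
  by apply: nneseries_le => [k|N]; [exact: (mge0_kendall_term k).2|exact: sum_kendall_term_le].
apply/lee_addgt0Pr => e e0.
have [j kj] : exists j, (kappa ^+ j <= e)%R.
  have /cvgr_le H : (kappa ^+ n @[n --> \oo] --> (0 : R))%R.
    by apply: cvg_expr; rewrite ger0_norm.
  by have [j _ /(_ j (leqnn j))] := H _ e0; exists j.
by apply: (le_trans (expR_le_nneseries_kendall_term j x0)); rewrite leeD2l// lee_fin.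
Qed.

End fixpoint.

End series.

(** * Roots of the Lundberg equation *)

Section roots.
Context {R : realType}.
Notation leb := (@lebesgue_measure R).
Notation MR := (measurableTypeR R).
Local Open Scope ereal_scope.

Lemma quadratic_root (c D v : R) : (0 < c)%R -> (0 < D)%R -> (0 < v)%R ->
  exists2 s, (0 < s)%R & (D * s ^+ 2 + c * s = v)%R.
Proof.
move=> c0 D0 v0; pose d := Num.sqrt (c ^+ 2 + 4 * D * v).
have d2 : (d ^+ 2 = c ^+ 2 + 4 * D * v)%R.
  by rewrite sqr_sqrtr// addr_ge0 ?sqr_ge0// !mulr_ge0// ltW.
have cd : (c < d)%R.
  rewrite -[c]ger0_norm ?(ltW c0)// -sqrtr_sqr ltr_sqrt; first by rewrite ltrDl !mulr_gt0.
  by rewrite ltr_wpDl ?sqr_ge0// !mulr_gt0.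
exists ((d - c) / (2 * D))%R; first by rewrite divr_gt0 ?subr_gt0 ?mulr_gt0.
have -> : (v = (d ^+ 2 - c ^+ 2) / (4 * D))%R by rewrite d2; field; rewrite gt_eqF.
by field; rewrite gt_eqF.
Qed.

(** Supplies the contraction constant: with the roots chosen later, the difference of the two
    exponentials is the sum over [k >= 1] of [Psi_k 1]. *)
Lemma expR_gap (a b : R) : (0 < a)%R -> (a < b)%R -> exists k : R,
  [/\ (0 <= k)%R, (k < 1)%R &
   forall x, (0 < x)%R -> (expR (- (a * x)) <= expR (- (b * x)) + k)%R].
Proof.
move=> a0 ab; have b0 := lt_trans a0 ab.
have e1 : (0 < 1 - expR (- 1) :> R)%R by rewrite subr_gt0 -expR0 ltr_expR oppr_lt0.
(* For [b * x <= 1] the second exponential is at least [expR (-1)] and the first at most 1;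
   otherwise the first is at most [expR (- (a / b))]. *)
exists (Num.max (1 - expR (-1)) (expR (- (a / b))))%R; split.
- by rewrite le_max (ltW e1).
- rewrite gt_max ltrBlDr ltrDl expR_gt0/= -expR0 ltr_expR oppr_lt0 divr_gt0//.
move=> x x0; have [bx|bx] := leP (b * x)%R 1%R.
  apply: (@le_trans _ _ (expR (-1) + (1 - expR (-1)))%R).
    by rewrite addrC subrK -expR0 ler_expR oppr_le0 mulr_ge0// ltW.
  by rewrite lerD ?ler_expR ?lerN2// le_max lexx.
rewrite -[leLHS]add0r lerD ?expR_ge0// le_max ler_expR lerN2.
rewrite ler_pdivrMr// -mulrA [(x * b)%R]mulrC; apply/orP; right.
by rewrite ler_peMr// ltW.
Qed.

Variable p : R -> R.
Hypotheses (mp : measurable_fun `](0 : R)%R, +oo[ p) (p_ge0 : forall x, (0 < x)%R -> (0 <= p x)%R).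
Hypothesis p1 : \int[leb]_(z in `]0%R, +oo[) (p z)%:E = 1.
Notation p0 := (pos_part p).

Lemma integral_pos_part (f : R -> R) :
  \int[leb]_(z in `]0%R, +oo[) (f z * p z)%:E = \int[leb]_z ((p0 z)%:E * (f z)%:E).
Proof.
rewrite integral_mkcond; apply: eq_integral => z _.
rewrite patchE mem_setE in_itv /= andbT /pos_part; case: ifPn => _; last by rewrite mul0e.
by rewrite -EFinM mulrC.
Qed.

Lemma integral_pos_part1 : \int[leb]_z (p0 z)%:E = 1.
Proof.
rewrite -p1 [RHS]integral_mkcond; apply: eq_integral => z _.
by rewrite patchE mem_setE in_itv /= andbT /pos_part; case: ifPn.
Qed.

Let intp : leb.-integrable `]0%R, +oo[ (EFin \o p).
Proof.
apply/integrableP; split; first exact/measurable_EFinP.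
rewrite (_ : \int[_]_(x in _) _ = 1) ?ltry//; rewrite -[RHS]p1.
apply: eq_integral => z; rewrite inE /= in_itv /= andbT => z0.
by rewrite ger0_norm ?p_ge0.
Qed.

Let intl s : (0 <= s)%R ->
  leb.-integrable `]0%R, +oo[ (EFin \o (fun x => expR (- (s * x)) * p x)%R).
Proof.
move=> s0; apply: (le_integrable _ _ _ intp) => //.
  apply/measurable_EFinP; apply: measurable_funM => //; apply: measurable_funTS.
  by apply: measurableT_comp => //; apply: measurableT_comp => //; exact: measurable_funM.
move=> z /=; rewrite in_itv /= andbT => z0.
rewrite lee_fin normrM ler_piMl// ger0_norm ?expR_ge0// -expR0 ler_expR oppr_le0 mulr_ge0//.
exact: ltW.
Qed.

Lemma laplaceE s : (0 <= s)%R ->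
  \int[leb]_z ((p0 z)%:E * (expR (- (s * z)))%:E) = (laplace p s)%:E.
Proof.
move=> s0; rewrite -(integral_pos_part (fun z => expR (- (s * z)))).
by rewrite /laplace /Rintegral fineK//; exact: integrable_fin_num (intl s0).
Qed.

Lemma laplace_ge0 s : (0 <= s)%R -> (0 <= laplace p s)%R.
Proof.
move=> s0; rewrite -lee_fin -laplaceE//; apply: integral_ge0 => z _.
by rewrite mule_ge0 ?lee_fin ?expR_ge0 ?pos_part_ge0.
Qed.

Lemma laplace_le1 s : (0 <= s)%R -> (laplace p s <= 1)%R.
Proof.
move=> s0; rewrite -lee_fin -p1 /laplace /Rintegral fineK; last first.
  exact: integrable_fin_num (intl s0).
apply: ge0_le_integral => //.
- move=> z /=; rewrite in_itv /= andbT => z0.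
  by rewrite lee_fin mulr_ge0 ?expR_ge0 ?p_ge0.
- by case/integrableP: (intl s0).
- exact/measurable_EFinP.
- move=> z /=; rewrite in_itv /= andbT => z0.
  rewrite lee_fin ler_piMl ?p_ge0// -expR0 ler_expR oppr_le0 mulr_ge0//.
  exact: ltW.
Qed.

(** Continuity under the integral sign, dominated by [p] itself. *)
Lemma laplace_continuous s : (0 < s)%R -> {for s, continuous (laplace p)}.
Proof.
move=> s0.
have := @continuity_under_integral R _ MR leb (fun s x => expR (- (s * x)) * p x)%R
  `]0%R, +oo[%classic _ 0%R (s + 1)%R _ _ p intp.
move=> H.
apply: H => //.
- move=> t /=; rewrite in_itv /= => /andP[t0 _]; exact: intl (ltW t0).
- apply: aeW => z _ t _; apply: cvgM; last exact: cvg_cst.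
  apply: (cvg_comp _ expR); last exact: continuous_expR.
  by apply: cvgN; apply: cvgM; [exact: cvg_id|exact: cvg_cst].
- move=> t /=; rewrite in_itv /= => /andP[t0 _]; apply: aeW => z /=.
  rewrite in_itv /= andbT => z0.
  rewrite ger0_norm ?mulr_ge0 ?expR_ge0 ?p_ge0// ler_piMl ?p_ge0//.
  by rewrite -expR0 ler_expR oppr_le0 mulr_ge0 ?ltW.
- by rewrite inE /= in_itv /= s0/= ltrDl.
Qed.

End roots.

Lemma quadratic_ltr (R : realType) (c D a b : R) : 0 < c -> 0 < D -> 0 < a -> 0 < b ->
  D * a ^+ 2 + c * a < D * b ^+ 2 + c * b -> a < b.
Proof.
move=> c0 D0 a0 b0; apply: contraTT; rewrite -!leNgt => ba.
by rewrite lerD// ler_pM2l// ler_pXn2r// nnegrE ltW.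
Qed.

Lemma expR_lundberg_root (R : realType) (c lambda sigma r delta : R) (p : R -> R) (s x : R) :
  0 < c -> 0 < lambda -> 0 < sigma ->
  measurable_fun `](0 : R), +oo[ p -> (forall z, 0 < z -> 0 <= p z) ->
  (\int[lebesgue_measure]_(z in `]0%R, +oo[) (p z)%:E = 1)%E ->
  0 < r -> r <= 1 -> 0 < delta -> 0 < s ->
  lundberg c lambda sigma r delta p s = 0 -> 0 < x ->
  (expR (- (s * x)))%:E =
  (\sum_(0 <= n <oo) kendall_term p (lambda + delta)%R c (sigma ^+ 2 / 2)%R (lambda * r) n x)%E.
Proof.
move=> c0 l0 sg0 mp p_ge0 p1 r0 r1 d0 s0 ls x0.
set q := lambda + delta; set D := sigma ^+ 2 / 2; set w := lambda * r.
have D0 : 0 < D by rewrite divr_gt0// exprn_gt0.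
have w0 : 0 < w by rewrite mulr_gt0.
have qw : 0 < q - w.
  by rewrite subr_gt0 /q /w (le_lt_trans (ler_piMr _ r1)) ?ltW// ltrDl.
(* [a] and [b] solve the Lundberg equation with the Laplace transform replaced by 1 and by 0
   respectively. *)
have [a a0 aE] := quadratic_root c0 D0 qw.
have [b b0 bE] := quadratic_root c0 D0 (addr_gt0 l0 d0).
have aE' : D * a ^+ 2 + c * a + w = q by rewrite aE subrK.
have bE' : D * b ^+ 2 + c * b + 0 = q by rewrite addr0.
have ab : a < b.
  by apply: (quadratic_ltr c0 D0 a0 b0); rewrite aE bE ltrBlDr ltrDl.
have [k [k0 k1 kE]] := expR_gap a0 ab.
have p01 := integral_pos_part1 p1.
apply: (@nneseries_kendall_term R p mp p_ge0 q c D w c0 D0 (ltW w0) a (ltW a0) aE'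
  s (laplace p s) s0 (laplaceE mp p_ge0 p1 (ltW s0)) _ k k0 _ x k1 x0).
  move: ls; rewrite /lundberg -/D -/q -/w => /eqP.
  by rewrite addrAC subr_eq0 => /eqP.
move=> y y0.
under eq_eseriesr do rewrite (climb_cst1 _ _ _ _ _ _ p01).
have coef0 v j : 0 <= v -> (0 <= (v ^+ j / j`!%:R)%:E * (y%:E * kernel_moment q c D j y))%E.
  by move=> v0; rewrite !mule_ge0 ?kernel_moment_ge0 ?lee_fin ?divr_ge0 ?exprn_ge0// ltW.
(* The series for [a] takes [v = w], the one for [b] takes [v = 0] and keeps only the term [k = 0];
   their difference is the sum to be bounded. *)
have Ha := nneseries_kernel_moment c0 D0 (ltW w0) (ltW a0) y0 aE'.
have Hb := nneseries_kernel_moment c0 D0 (lexx 0) (ltW b0) y0 bE'.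
rewrite nneseriesS in Ha; last by move=> j; apply: coef0; exact: ltW.
rewrite nneseriesS in Hb; last by move=> j; exact: coef0.
rewrite [X in (_ + X)%E]eseries0 ?adde0 in Hb; last first.
  by move=> j _ _; rewrite expr0n mul0r mul0e.
rewrite !expr0 in Ha Hb.
rewrite Hb in Ha.
rewrite -(@leeD2lE _ (expR (- (b * y)))%:E)// Ha -EFinD lee_fin.
exact: kE.
Qed.

(** The Laplace transform lies between 0 and 1, so the function changes sign between the roots of
    the two quadratics obtained from these values. *)
Lemma lundberg_root_exists (R : realType) (c lambda sigma r delta : R) (p : R -> R) :
  0 < c -> 0 < lambda -> 0 < sigma ->
  measurable_fun `](0 : R), +oo[ p -> (forall z, 0 < z -> 0 <= p z) ->
  (\int[lebesgue_measure]_(z in `]0%R, +oo[) (p z)%:E = 1)%E ->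
  0 < r -> r <= 1 -> 0 < delta ->
  exists2 s, 0 < s & lundberg c lambda sigma r delta p s = 0.
Proof.
move=> c0 l0 sg0 mp p_ge0 p1 r0 r1 d0.
set q := lambda + delta; set D := sigma ^+ 2 / 2; set w := lambda * r.
have D0 : 0 < D by rewrite divr_gt0// exprn_gt0.
have w0 : 0 < w by rewrite mulr_gt0.
have qw : 0 < q - w.
  by rewrite subr_gt0 /q /w (le_lt_trans (ler_piMr _ r1)) ?ltW// ltrDl.
have [a a0 aE] := quadratic_root c0 D0 qw.
have [b b0 bE] := quadratic_root c0 D0 (addr_gt0 l0 d0).
have ab : a <= b.
  by apply: ltW; apply: (quadratic_ltr c0 D0 a0 b0); rewrite aE bE ltrBlDr ltrDl.
have fa : lundberg c lambda sigma r delta p a <= 0.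
  rewrite /lundberg -/D -/q -/w aE (addrAC q) subrr sub0r addrC subr_le0.
  by rewrite ler_piMr ?(ltW w0)// (laplace_le1 mp p_ge0 p1 (ltW a0)).
have fb : 0 <= lundberg c lambda sigma r delta p b.
  rewrite /lundberg -/D -/q -/w bE subrr add0r.
  by rewrite mulr_ge0 ?(ltW w0)// (laplace_ge0 mp p_ge0 p1 (ltW b0)).
have cl : {within `[a, b], continuous (lundberg c lambda sigma r delta p)}.
  apply: continuous_in_subspaceT => s; rewrite inE /= in_itv /= => /andP[as_ _].
  have s0 : 0 < s by exact: lt_le_trans as_.
  apply: cvgD; last first.
    by apply: cvgM; [exact: cvg_cst|exact: (laplace_continuous mp p_ge0 p1 s0)].
  apply: cvgB; last exact: cvg_cst.
  apply: cvgD; apply: cvgM; [exact: cvg_cst|exact: exprn_continuous|exact: cvg_cst|exact: cvg_id].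
have [|s sab ls] := @IVT _ _ a b 0 ab cl.
  by rewrite ge_min fa le_max fb orbT.
exists s => //; move: sab; rewrite in_itv /= => /andP[as_ _].
exact: lt_le_trans as_.
Qed.

(** * Uniqueness of the root and the series expansion *)

Unset Implicit Arguments.

Theorem proposition1 (R : realType) (c lambda sigma : R)
  (hc : 0 < c) (hlambda : 0 < lambda) (hsigma : 0 < sigma)
  (d : measure_display) (T : measurableType d) (P : probability T R)
  (X1 : {RV P >-> R}) (p : R -> R)
  (hX1 : {ae P, forall w, 0 < X1 w})
  (hp : has_pos_density X1 p)
  (net_profit : (lambda%:E * 'E_P[X1] < c%:E)%E)
  (r delta : R) (hr0 : 0 < r) (hr1 : r <= 1) (hdelta : 0 < delta)
  (x : R) (hx : 0 < x) :
  ((expR (- (rho c lambda sigma r delta p * x)))%:E =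
   \sum_(0 <= n <oo) ((r ^+ n)%:E *
     \int[lebesgue_measure]_(s in `]0%R, +oo[)
       ((expR (- (delta * s)) * (x / s))%:E * g c lambda sigma p s n x)))%E.
Proof.
have [mp p_ge0 pE] := hp.
have p1 : (\int[lebesgue_measure]_(z in `]0%R, +oo[) (p z)%:E = 1)%E.
  by have := pE setT measurableT; rewrite probability_setT setTI => <-.
pose rootE s y := @expR_lundberg_root R c lambda sigma r delta p s y
  hc hlambda hsigma mp p_ge0 p1 hr0 hr1 hdelta.
have [s s0 ls] := @lundberg_root_exists R c lambda sigma r delta p
  hc hlambda hsigma mp p_ge0 p1 hr0 hr1 hdelta.
(* Both roots represent the same series at [x = 1], and the exponential is injective. *)
have s_uniq u : 0 < u -> lundberg c lambda sigma r delta p u = 0 -> u = s.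
  move=> u0 lu; have := rootE u 1 u0 lu ltr01.
  rewrite -(rootE s 1 s0 ls ltr01) !mulr1 => -[/expR_inj].
  exact: oppr_inj.
have E : [set u | 0 < u /\ lundberg c lambda sigma r delta p u = 0] = [set s].
  by apply/seteqP; split => [u [u0 lu]|_ ->]; [exact: s_uniq|].
(* The set of positive roots is now known to be a singleton, so the default value of the description
   is not taken. *)
have -> : rho c lambda sigma r delta p = s.
  apply: xget_unique => // y; rewrite /= E => sy.
  by have : [set s] s by []; rewrite sy => ->.
rewrite (rootE s x s0 ls hx); apply: eq_eseriesr => n _.
by rewrite kendall_termE.
Qed.
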